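(* Let $d\ge2$ and let $V,q$ satisfy Condition (A$_l$) of the context for some integer $l\ge2$. Fix any $\mu>\mu'>0$, put $I=I_{\mu'}=[\mu'^2/2,\infty)$, and let $S=S(\lambda,x)$, $\lambda\in I$, be the geometric eikonal solution described in the context, for $R>0$ sufficiently large. Then for each $(t,x)\in\Omega_\mu=\{(t,x)\in\mathbb R_+\times\mathbb R^d: |x|\ge\mu t\}$ there exists a unique critical point $\lambda_c=\lambda_c(t,x)\in I$ of $$\widetilde K(\lambda,t,x)=S(\lambda,x)-\lambda t$$ considered as a function of $\lambda\in I$. In addition, if one sets $K(t,x)=\widetilde K(\lambda_c(t,x),t,x)$, then: (1) $K\in C^l(\Omega_\mu)$, and it solves $\partial_tK+\tfrac12|\nabla_xK|^2+\chi_RV=0$ on $\Omega_\mu$. (2) There exists $C>0$, independent of all large $R$, such that for any $k\in\mathbb N_0,\alpha\in\mathbb N_0^d$ with $k+|\alpha|\le2$ and any $(t,x)\in\Omega_\mu$ $$\bigl|\partial_t^k\partial_x^\alpha\bigl(K(t,x)-x^2/(2t)\bigr)\bigr|\le C\,t^{1-k}\langle x\rangle^{-\sigma-|\alpha|}.$$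
   Context: $\mathbb R_+=(0,\infty)$, $\mathbb N_0=\{0,1,\dots\}$, $\langle x\rangle=(1+|x|^2)^{1/2}$, $x^2=|x|^2$. Condition (A$_l$): $V\in C^l(\mathbb R^d;\mathbb R)$ and there are $\sigma\in(0,1)$, $\rho\in(0,1]$, $C>0$ such that $|\partial^\alpha V(x)|\le C\langle x\rangle^{-m(|\alpha|)}$ for all $|\alpha|\le l$ and $x\in\mathbb R^d$, where $m(k)=\sigma+k$ for $k=0,1,2$ and $m(k)=\sigma+2+\tfrac{\rho+1}2(k-2)$ for $k=2,\dots,l$. Moreover $q:\mathbb R^d\to\mathbb R$ is measurable, and for some $\tau\in(0,1)$ the operator $\langle x\rangle^{1+\tau}q(x)(-\Delta+1)^{-1}$ is compact on $L^2(\mathbb R^d)$; and the self-adjoint operator $H=-\tfrac12\Delta+V+q$ has no positive eigenvalues. Fix $\chi\in C^\infty(\mathbb R;\mathbb R)$ with $\chi(t)=0$ for $t\le4/3$, $\chi(t)=1$ for $t\ge5/3$, $\chi'\ge0$, and set $\chi_R(x)=\chi(|x|/R)$. Geometric eikonal solution: for a closed interval $I\subset\mathbb R_+$ (closed in $\mathbb R$) and $R$ large, $S(\lambda,x)$ is the geodesic distance from $0$ to $x$ in the Riemannian metric $2(\lambda-\chi_RV)\,\mathrm dx^2$ on $\mathbb R^d$, $\lambda\in I$. It is known that for some $R_0>0$ and all $R\ge R_0$: $S\in C^l(I\times(\mathbb R^d\setminus\{0\}))$, $\tfrac12|\nabla_xS|^2+\chi_RV=\lambda$, $S=\sqrt{2\lambda}|x|(1+s)$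 with $s\in C^l(I\times\mathbb R^d)$ vanishing for $|x|\le R$, and $|\partial_\lambda^k\partial_x^\alpha s|\le C\lambda^{-1-k}\langle x\rangle^{-m(k+|\alpha|)+k}$ for $k+|\alpha|\le l$, with $C$ independent of $R\ge R_0$. The function $K$ is called the Legendre transform of $S$. *)

(* Defs.v *)
From HB Require Import structures.
From mathcomp Require Import all_boot all_order all_algebra.
From mathcomp Require Import all_classical all_reals all_analysis.
From mathcomp Require Import complex.
Set Implicit Arguments.
Unset Strict Implicit.
Unset Printing Implicit Defensive.
Import Order.TTheory GRing.Theory Num.Theory.
Import numFieldNormedType.Exports.
Local Open Scope classical_set_scope.
Local Open Scope ring_scope.

Section Euclidean.
Context {R : realType} {d : nat}.
Implicit Types x : 'rV[R]_d.

(* The library norm `|x| on 'rV[R]_d is the sup norm (same topology). *)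
Definition enorm x : R := Num.sqrt (\sum_(i < d) x 0 i ^+ 2).

Definition jap x : R := Num.sqrt (1 + enorm x ^+ 2).

Definition evec (i : 'I_d) : 'rV[R]_d := delta_mx 0 i.

End Euclidean.

(* Differentiation relative to a set D that need not be open: difference
   quotients only use points of D.  At interior points of D these are the
   ordinary partial derivatives (pderivE below); at boundary points they are
   one-sided.  The sets used in the statement are R^d, a closed half-line I,
   I x (R^d \ {0}), I x R^d and {(t, x) | 0 < t, mu * t <= |x|}; each of their
   points is an accumulation point of the set along every coordinate axis, so
   that the limits are unique, and C^k below is the usual notion: C^k in the
   interior, with all partial derivatives of order <= k extending continuously
   to the set. *)
Section RelativeDerivatives.
Context {R : realType} {U : normedModType R}.
Implicit Types (D : set U) (v x : U) (f : U -> R).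

Definition diff_quot v f x : R -> R :=
  fun h => h^-1 *: ((f \o shift x) (h *: v) - f x).

Definition pderivable D v f x : Prop :=
  cvg (diff_quot v f x @ within [set h : R | D (h *: v + x)] 0^').

Definition pderiv D v f x : R :=
  lim (diff_quot v f x @ within [set h : R | D (h *: v + x)] 0^').

Fixpoint Ck (J : Type) (b : J -> U) D (k : nat) f : Prop :=
  {within D, continuous f} /\
  if k is k'.+1 then
    forall j, (forall x, D x -> pderivable D (b j) f x) /\
              Ck b D k' (pderiv D (b j) f)
  else True.

Definition multi_pderiv (n : nat) (b : 'I_n -> U) D (alpha : 'I_n -> nat) f
    : U -> R :=
  foldr (fun i g => iter (alpha i) (pderiv D (b i)) g) f (enum 'I_n).

Lemma within_interior D v x : nbhs x D ->
  within [set h : R | D (h *: v + x)] (0 : R)^' = (0 : R)^'.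
Proof.
move=> Dx; have near0 : (0 : R)^' [set h : R | D (h *: v + x)].
  apply: (@nbhs_dnbhs _ _ _ _); rewrite /=.
  have cv : (fun h : R => h *: v + x) @ (0 : R) --> x.
    rewrite -[X in _ --> X]add0r -(scale0r v).
    by apply: cvgD; [apply: cvgZr_tmp; exact: cvg_id|exact: cvg_cst].
  exact: cv.
rewrite eqEsubset; split => A; rewrite /within /= => nA.
  by apply: filterS2 near0 nA => h Dh; apply.
by apply: filterS nA => h.
Qed.

Lemma pderivE D v f x : nbhs x D -> pderiv D v f x = 'D_v f x.
Proof. by move=> Dx; rewrite /pderiv within_interior. Qed.

Lemma pderivableE D v f x : nbhs x D -> pderivable D v f x = derivable f x v.
Proof. by move=> Dx; rewrite /pderivable within_interior. Qed.

End RelativeDerivatives.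

Definition multi_order {n : nat} (alpha : 'I_n -> nat) : nat :=
  (\sum_i alpha i)%N.

Section Lebesgue.
Context (R : realType) (d : nat).
Implicit Types (A : set 'rV[R]_d) (C : set ('rV[R]_d * 'rV[R]_d)).

Definition box (c : 'rV[R]_d * 'rV[R]_d) : set 'rV[R]_d :=
  [set x | forall i, c.1 0 i < x 0 i < c.2 0 i].

Definition box_volume (c : 'rV[R]_d * 'rV[R]_d) : \bar R :=
  (\prod_(i < d) Num.max 0 (c.2 0 i - c.1 0 i))%:E.

Definition box_covers A : set (set ('rV[R]_d * 'rV[R]_d)) :=
  [set C | countable C /\ A `<=` \bigcup_(c in C) box c].

Definition lebesgue_outer A : \bar R :=
  ereal_inf [set (\esum_(c in C) box_volume c)%E | C in box_covers A].

Lemma box_volume_ge0 c : (0 <= box_volume c)%E.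
Proof. by rewrite lee_fin; apply: prodr_ge0 => i _; rewrite le_max lexx. Qed.

Lemma lebesgue_outer_ge0 A : (0 <= lebesgue_outer A)%E.
Proof.
apply: le_ereal_inf_tmp => _ [C _ <-]; apply: esum_ge0 => c _.
exact: box_volume_ge0.
Qed.

Lemma lebesgue_outer0 : lebesgue_outer set0 = 0%E.
Proof.
apply/eqP; rewrite eq_le lebesgue_outer_ge0 andbT.
apply: ereal_inf_lbound; exists set0; last exact: esum_set0.
by split => //; exact: countable0.
Qed.

Lemma le_lebesgue_outer : {homo lebesgue_outer : A B / A `<=` B >-> (A <= B)%E}.
Proof.
move=> A B AB; apply: ereal_inf_le_tmp => _ [C [cC BC] <-].
by exists C => //; split => //; exact: subset_trans BC.
Qed.

Lemma lebesgue_outer_sigma_subadditive : sigma_subadditive lebesgue_outer.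
Proof.
move=> A; have [[i ioo]|] := pselect (exists i, lebesgue_outer (A i) = +oo%E).
  rewrite (eseries_pinfty _ _ ioo) ?leey// => n _.
  by rewrite -ltNye (lt_le_trans _ (lebesgue_outer_ge0 _)).
rewrite -forallNE => Aoo.
apply/lee_addgt0Pr => _/posnumP[e].
apply: le_trans (epsilon_trick _ _ _) => //; last first.
  by move=> n; exact: lebesgue_outer_ge0.
pose P n C := box_covers (A n) C /\ (\esum_(c in C) box_volume c <=
  lebesgue_outer (A n) + (e%:num / (2 ^ n.+1)%:R)%:E)%E.
have [G PG] : {G : nat -> set ('rV[R]_d * 'rV[R]_d) & forall n, P n (G n)}.
  apply: (@choice _ _ P) => n.
  have en1 : 0 < e%:num / (2 ^ n.+1)%:R :> R by [].
  have fn : lebesgue_outer (A n) \is a fin_num.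
    rewrite ge0_fin_numE; last exact: lebesgue_outer_ge0.
    by rewrite ltey; apply/eqP; exact: Aoo.
  have [_ [C cC <-] /ltW Cle] := lb_ereal_inf_adherent en1 fn.
  by exists C.
apply: (@le_trans _ _ (\esum_(c in \bigcup_n G n) box_volume c)%E).
  apply: ereal_inf_lbound; exists (\bigcup_n G n) => //; split.
    by apply: bigcup_countable => // n _; exact: (PG n).1.1.
  move=> x [n _ /(PG n).1.2[c Gc cx]].
  by exists c => //; exists n.
rewrite seqDU_bigcup_eq esum_bigcupT; [|exact: trivIset_seqDU|exact: box_volume_ge0].
rewrite -nneseries_esumT; last first.
  by move=> n; apply: esum_ge0 => c _; exact: box_volume_ge0.
apply: lee_nneseries => [n _ _|n _].
  by apply: esum_ge0 => c _; exact: box_volume_ge0.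
apply: le_trans (PG n).2.
rewrite esum_mkcond [leRHS]esum_mkcond; apply: le_esum => c _.
case: ifPn => [/set_mem cG|_].
  by rewrite mem_set//; exact: subset_seqDU cG.
by case: ifPn => // _; exact: box_volume_ge0.
Qed.

HB.instance Definition _ := isOuterMeasure.Build R 'rV[R]_d lebesgue_outer
  lebesgue_outer0 lebesgue_outer_ge0 le_lebesgue_outer
  lebesgue_outer_sigma_subadditive.

Definition lebesgue_outer_measure : {outer_measure set 'rV[R]_d -> \bar R} :=
  lebesgue_outer.

(* R^d with the sigma-algebra of Lebesgue measurable sets, on which
   lebesgue_outer is the (complete) d-dimensional Lebesgue measure. *)
Definition lebesgue_space := caratheodory_type lebesgue_outer_measure.

HB.instance Definition _ := Measurable.on lebesgue_space.

Definition lebesgue_rV : {measure set lebesgue_space -> \bar R} :=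
  lebesgue_outer_measure :
    {measure set (caratheodory_type lebesgue_outer_measure) -> \bar R}.

Definition lebesgue_measurable (f : 'rV[R]_d -> R) : Prop :=
  measurable_fun [set: lebesgue_space] (f : lebesgue_space -> R).

End Lebesgue.

(* Functions in L^2(R^d; C) are represented by everywhere defined functions;
   every notion below is invariant under modification on null sets. *)
Section L2.
Context {R : realType} {d : nat}.
Implicit Types (phi : 'rV[R]_d -> R) (u f g : 'rV[R]_d -> R[i]).

Definition L2_sqnorm u : \bar R :=
  (\int[lebesgue_rV R d]_x (complex.Re (u x) ^+ 2 + complex.Im (u x) ^+ 2)%:E)%E.

Definition L2 u : Prop :=
  [/\ lebesgue_measurable (fun x => complex.Re (u x)),
      lebesgue_measurable (fun x => complex.Im (u x)) &
      (L2_sqnorm u < +oo)%E].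

Definition test_function phi : Prop :=
  (forall k, Ck evec setT k phi) /\
  exists M : R, forall x, M < enorm x -> phi x = 0.

Definition laplacian phi (x : 'rV[R]_d) : R :=
  \sum_(i < d) 'D_(evec i) ('D_(evec i) phi) x.

(* Delta u = g in the sense of distributions. *)
Definition weak_laplacian u g : Prop := forall phi, test_function phi ->
  \int[lebesgue_rV R d]_x (complex.Re (u x) * laplacian phi x) =
    \int[lebesgue_rV R d]_x (complex.Re (g x) * phi x) /\
  \int[lebesgue_rV R d]_x (complex.Im (u x) * laplacian phi x) =
    \int[lebesgue_rV R d]_x (complex.Im (g x) * phi x).

(* Graph of (-Delta + 1)^-1, where -Delta is the self-adjoint operator with
   domain H^2(R^d), i.e. {u in L^2 | Delta u in L^2}. *)
Definition free_resolvent f u : Prop :=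
  [/\ L2 f, L2 u & weak_laplacian u (fun x => u x - f x)].

(* Compactness on L^2 of the operator with graph T. *)
Definition compact_on_L2
    (T : ('rV[R]_d -> R[i]) -> ('rV[R]_d -> R[i]) -> Prop) : Prop :=
  (forall f, L2 f -> exists2 g, L2 g & T f g) /\
  forall f_ g_ : nat -> 'rV[R]_d -> R[i],
    (forall n, L2 (f_ n) /\ T (f_ n) (g_ n)) ->
    (exists M : R, forall n, (L2_sqnorm (f_ n) <= M%:E)%E) ->
    exists (r : nat -> nat) g,
      [/\ {homo r : m n / (m < n)%N}, L2 g &
          L2_sqnorm (fun x => g_ (r n) x - g x) @[n --> \oo] --> 0%E].

Definition weighted_resolvent (tau : R) (q : 'rV[R]_d -> R) f g : Prop :=
  exists2 u, free_resolvent f u &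
    {ae lebesgue_rV R d, forall x, g x = ((jap x `^ (1 + tau) * q x)%:C)%C * u x}.

(* Graph of H = - Delta / 2 + V + q on H^2(R^d).  For V bounded and q
   relatively compact with respect to -Delta, as in condition_A below, this is
   the self-adjoint realization of H (Kato-Rellich). *)
Definition schroedinger (V q : 'rV[R]_d -> R) u f : Prop :=
  [/\ L2 u, L2 f &
      exists g, [/\ L2 g, weak_laplacian u g &
        {ae lebesgue_rV R d, forall x,
           f x = - ((2^-1)%:C)%C * g x + ((V x + q x)%:C)%C * u x}]].

Definition schroedinger_eigenvalue (V q : 'rV[R]_d -> R) (E : R) : Prop :=
  exists2 u, (0 < L2_sqnorm u)%E & schroedinger V q u (fun x => (E%:C)%C * u x).

End L2.

Section Potential.
Context {R : realType} {d : nat}.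

Definition decay_rate (sigma rho : R) (k : nat) : R :=
  if (k <= 2)%N then sigma + k%:R
  else sigma + 2 + (rho + 1) / 2 * (k%:R - 2).

Definition condition_A (l : nat) (sigma rho : R) (V q : 'rV[R]_d -> R) : Prop :=
  [/\ 0 < sigma < 1, 0 < rho <= 1,
      Ck evec setT l V &
      exists2 C : R, 0 < C &
        forall (alpha : 'I_d -> nat) x, (multi_order alpha <= l)%N ->
          `|multi_pderiv evec setT alpha V x| <=
            C * jap x `^ (- decay_rate sigma rho (multi_order alpha))] /\
  [/\ lebesgue_measurable q,
      exists2 tau : R, 0 < tau < 1 & compact_on_L2 (weighted_resolvent tau q) &
      forall E : R, 0 < E -> ~ schroedinger_eigenvalue V q E].

End Potential.

Section Eikonal.
Context {R : realType} {d : nat}.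
Implicit Types (V : 'rV[R]_d -> R) (chi : R -> R) (I : set R).

Definition cutoff chi : Prop :=
  [/\ forall n t, derivable (derive1n n chi) t 1,
      forall t, t <= 4 / 3 -> chi t = 0,
      forall t, 5 / 3 <= t -> chi t = 1 &
      forall t, 0 <= derive1 chi t].

Definition cut_potential chi V (r : R) (x : 'rV[R]_d) : R :=
  chi (enorm x / r) * V x.

(* Length of gamma : [0, 1] -> R^d in the metric 2 (lambda - W) dx^2. *)
Definition curve_length (W : 'rV[R]_d -> R) (lambda : R)
    (gamma : R -> 'rV[R]_d) : R :=
  \int[lebesgue_measure]_(s in `[0, 1])
    (Num.sqrt (2 * (lambda - W (gamma s))) * enorm (derive1 gamma s)).

Definition C1_curve (x y : 'rV[R]_d) (gamma : R -> 'rV[R]_d) : Prop :=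
  [/\ forall s, derivable gamma s 1, continuous (derive1 gamma),
      gamma 0 = x & gamma 1 = y].

Definition geodesic_distance (W : 'rV[R]_d -> R) (lambda : R)
    (x y : 'rV[R]_d) : R :=
  inf [set curve_length W lambda gamma | gamma in C1_curve x y].

Definition eikonal_solution chi V (r : R) (p : R * 'rV[R]_d) : R :=
  geodesic_distance (cut_potential chi V r) p.1 0 p.2.

(* Coordinate directions of R x R^d; None is the scalar variable (the energy
   lambda or the time t). *)
Definition sdir : R * 'rV[R]_d := (1, 0).
Definition xdir (i : 'I_d) : R * 'rV[R]_d := (0, evec i).
Definition sxdir (j : option 'I_d) : R * 'rV[R]_d :=
  if j is Some i then xdir i else sdir.

Definition mixed_pderiv (D : set (R * 'rV[R]_d)) (k : nat) (alpha : 'I_d -> nat)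
    (f : R * 'rV[R]_d -> R) : R * 'rV[R]_d -> R :=
  iter k (pderiv D sdir) (multi_pderiv xdir D alpha f).

Definition sq_gradx (D : set (R * 'rV[R]_d)) (f : R * 'rV[R]_d -> R)
    (p : R * 'rV[R]_d) : R :=
  \sum_(i < d) pderiv D (xdir i) f p ^+ 2.

(* The known regularity theory of the geodesic distance S on energies I: the
   eikonal equation and S = sqrt (2 lambda) |x| (1 + s) with the bounds on s,
   uniformly in the cut-off radius r >= r0. *)
Definition eikonal_regularity (l : nat) (sigma rho : R) chi V I : Prop :=
  let m := decay_rate sigma rho in
  exists r0 C : R, [/\ 0 < r0, 0 < C & forall r, r0 <= r ->
    let S := eikonal_solution chi V r in
    let D := I `*` [set x : 'rV[R]_d | x != 0] in
    let D' := I `*` [set: 'rV[R]_d] in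
    [/\ Ck sxdir D l S,
        forall p, D p -> 2^-1 * sq_gradx D S p + cut_potential chi V r p.2 = p.1
      & exists s : R * 'rV[R]_d -> R,
        [/\ Ck sxdir D' l s,
            forall lambda x, I lambda -> enorm x <= r -> s (lambda, x) = 0,
            forall lambda x, I lambda -> S (lambda, x) =
              Num.sqrt (2 * lambda) * enorm x * (1 + s (lambda, x)) &
            forall k alpha lambda x, (k + multi_order alpha <= l)%N ->
              I lambda ->
              `|mixed_pderiv D' k alpha s (lambda, x)| <=
                C * lambda ^- k.+1 *
                jap x `^ (- m (k + multi_order alpha)%N + k%:R)]]].

Definition energies (mu : R) : set R := `[mu ^+ 2 / 2, +oo[%classic.

Definition outgoing (mu : R) : set (R * 'rV[R]_d) :=
  [set p | 0 < p.1 /\ mu * p.1 <= enorm p.2].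

(* K-tilde (lambda, t, x). *)
Definition phase chi V (r t : R) (x : 'rV[R]_d) (lambda : R) : R :=
  eikonal_solution chi V r (lambda, x) - lambda * t.

(* One-sided derivative at the end points of I. *)
Definition critical_point I (f : R -> R) (a : R) : Prop :=
  [/\ I a, pderivable I 1 f a & pderiv I 1 f a = 0].

End Eikonal.

(* Main.v *)
Require Import Defs.
From mathcomp Require Import all_boot all_order all_algebra.
From mathcomp Require Import all_classical all_reals all_analysis.
From mathcomp Require Import ring lra.
Import Order.TTheory GRing.Theory Num.Theory.
Import numFieldNormedType.Exports.
Local Open Scope classical_set_scope.
Local Open Scope ring_scope.
Set Implicit Arguments.
Unset Strict Implicit.

(* With w = sqrt (2 lambda), S = w |x| (1 + s) gives
   d_lambda S = (|x| / w) (1 + e) and d_lambda^2 S = - (|x| / w^3) (1 + e'),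
   where e and e' are small for large R.  So d_lambda S decreases strictly in
   lambda, exceeds t at the left end point of I (because 1 + e > mu' / mu there
   while |x| >= mu t) and tends to 0: the critical point exists, is unique and
   lies in the interior of I.  Implicit differentiation along the lines
   lambda |-> (lambda, x) gives the regularity of lambda_c, and
   d_t K = - lambda_c, grad_x K = grad_x S (lambda_c, x), so that the eikonal
   equation is the Hamilton-Jacobi equation.  For the estimates insert
   w t = |x| (1 + e) in K and its derivatives: each difference with the free
   phase is |x|^(2 - |alpha|) t^(- 1 - k) times a quantity of size
   M = 4 C <x>^-sigma / lambda, and |x|^2 / lambda <= 8 t^2. *)

(** * Relative derivatives *)

(** The set Omega is not open and all derivatives are relative to sets, so the classical implicit
    function theorem and the chain rule for jointly differentiable maps do not apply directly. They
    are replaced by the special shape of the substitution p |-> (lambda_c p, p.2): an increment of a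
    function along it is a vertical increment, handled by the mean value theorem in lambda, plus an
    increment at fixed lambda, which is already a difference quotient. The vertical segments must
    stay where derivatives are ordinary ones. The strict inequality mu' < mu secures this: it keeps
    critical points off the end point of I, hence in an open half-cylinder. Implicit differentiation
    costs one derivative, so lambda_c is only C^(l-1); K is nevertheless C^l, because stationarity
    removes the derivatives of lambda_c from the first derivatives of K. A large R makes the
    perturbation small: s vanishes for |x| <= R, and elsewhere <x>^-sigma / lambda is at most a
    constant times R^-sigma, as lambda is bounded below on I. *)

Section RelativeCalculus.
Context {R : realType} {U : normedModType R}.
Implicit Types (D : set U) (v x : U) (f g : U -> R).

Definition dirnbhs D v x : set_system R :=
  within [set h : R | D (h *: v + x)] 0^'.

(** A relation rather than the value [pderiv], which is a [lim]: rules for sums, products and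
    quotients then need no uniqueness of limits. Uniqueness enters only through [adherent], in
    [pderiv_val]. *)
Definition is_pderiv D v f x (l : R) : Prop :=
  diff_quot v f x @ dirnbhs D v x --> l.

Definition adherent D v x : Prop :=
  forall e : R, 0 < e -> exists h, [/\ h != 0, `|h| < e & D (h *: v + x)].

#[global] Instance dirnbhs_filter D v x : Filter (dirnbhs D v x).
Proof. by rewrite /dirnbhs; apply: within_filter. Qed.

Lemma dirnbhs_proper D v x : adherent D v x -> ProperFilter (dirnbhs D v x).
Proof.
move=> acc; apply: Build_ProperFilter_ex => P.
rewrite /dirnbhs /within /= => /nbhs_ballP[e /= e0 eP].
have [h [h0 he Dh]] := acc _ e0.
exists h; apply: eP => //.
by rewrite /ball /= sub0r normrN.
Qed.

Lemma near_dirnbhs D v x (P : set R) :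
  (exists2 e : R, 0 < e & forall h, h != 0 -> `|h| < e -> D (h *: v + x) -> P h)
  -> (dirnbhs D v x) P.
Proof.
move=> [e e0 eP]; rewrite /dirnbhs /within /=.
apply/nbhs_ballP; exists e => //= h.
by rewrite /ball /= sub0r normrN => he h0 Dh; apply: eP.
Qed.

Lemma near_dirnbhs_in D v x :
  \forall h \near dirnbhs D v x, h != 0 /\ D (h *: v + x).
Proof. by apply: near_dirnbhs; exists 1. Qed.

Lemma cvg_dirnbhs0 D v x : (id : R -> R) @ dirnbhs D v x --> (0 : R).
Proof.
apply/cvgrPdist_lt => e e0; apply: near_dirnbhs; exists e => // h _ he _ /=.
by rewrite sub0r normrN.
Qed.

Lemma cvg_dirnbhs D v x : (fun h : R => h *: v + x) @ dirnbhs D v x --> x.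
Proof.
rewrite -[X in _ --> X]add0r -(scale0r v); apply: cvgD; last exact: cvg_cst.
by apply: cvgZr_tmp; exact: cvg_dirnbhs0.
Qed.

Lemma cvg_dirnbhs_within D v x :
  (fun h : R => h *: v + x) @ dirnbhs D v x --> within D (nbhs x).
Proof.
move=> A; rewrite /within /= => DA.
have {}DA := @cvg_dirnbhs D v x _ DA.
rewrite /nbhs /= in DA *.
apply: filterS2 DA (near_dirnbhs_in D v x) => h /= hA [_ Dh].
exact: hA.
Qed.

Lemma is_pderiv_pderivable D v f x l :
  is_pderiv D v f x l -> pderivable D v f x.
Proof. by move=> fl; apply/cvg_ex; exists l. Qed.

Lemma pderiv_val D v f x l : adherent D v x ->
  is_pderiv D v f x l -> pderiv D v f x = l.
Proof. by move=> /dirnbhs_proper Hp fl; apply: cvg_lim. Qed.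

Lemma pderivableP D v f x :
  pderivable D v f x -> is_pderiv D v f x (pderiv D v f x).
Proof. by []. Qed.

Lemma dirnbhs_sub D D' v x : D `<=` D' -> dirnbhs D v x `=>` dirnbhs D' v x.
Proof.
by move=> DD' A; rewrite /dirnbhs /within /=; apply: filterS => h hA /DD'/hA.
Qed.

Lemma is_pderiv_sub D D' v f x l : D `<=` D' ->
  is_pderiv D' v f x l -> is_pderiv D v f x l.
Proof.
move=> DD' fl; apply: cvg_trans fl.
by apply: cvg_app; exact: dirnbhs_sub.
Qed.

Lemma is_pderiv_ext D v f g x l : D x -> {in D, f =1 g} ->
  is_pderiv D v f x l -> is_pderiv D v g x l.
Proof.
move=> Dx fg; apply: cvg_trans; apply: near_eq_cvg.
apply: filterS (near_dirnbhs_in D v x) => h [_ Dh].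
by rewrite /diff_quot /= !fg// inE.
Qed.

Lemma pderiv_ext D v f g x : D x -> {in D, f =1 g} ->
  adherent D v x -> pderivable D v f x -> pderiv D v g x = pderiv D v f x.
Proof.
by move=> Dx fg acc /pderivableP /(is_pderiv_ext Dx fg); exact: pderiv_val.
Qed.

Lemma is_pderiv_cst D v x (c : R) : is_pderiv D v (cst c) x 0.
Proof.
rewrite /is_pderiv (_ : diff_quot _ _ _ = cst 0); first exact: cvg_cst.
by apply/funext => h; rewrite /diff_quot /= subrr scaler0.
Qed.

Lemma is_pderiv0 D f x : is_pderiv D 0 f x 0.
Proof.
rewrite /is_pderiv (_ : diff_quot _ _ _ = cst 0); first exact: cvg_cst.
by apply/funext => h; rewrite /diff_quot /= scaler0 add0r subrr scaler0.
Qed.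

(** With the increment factored as [h * q h], a derivative is the limit of the slope [q]; what
    remains of many rules below is an algebraic factorization. *)
Lemma is_pderiv_near D v f x l (q : R -> R) :
  (forall h, h != 0 -> D (h *: v + x) -> f (h *: v + x) - f x = h * q h) ->
  q @ dirnbhs D v x --> l -> is_pderiv D v f x l.
Proof.
move=> fq; apply: cvg_trans; apply: near_eq_cvg.
apply: filterS (near_dirnbhs_in D v x) => h [h0 Dh].
by rewrite /diff_quot /= fq// scalerA mulVf// scale1r.
Qed.

(** Continuity along the direction [v] only, which is all that the product, quotient and square root
    rules use. *)
Lemma is_pderiv_cvg D v f x l : is_pderiv D v f x l ->
  (fun h => f (h *: v + x)) @ dirnbhs D v x --> f x.
Proof.
move=> fl; have : (fun h => f x + h * diff_quot v f x h) @ dirnbhs D v x --> f x.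
  rewrite -[X in _ --> X]addr0 -(mul0r l); apply: cvgD; first exact: cvg_cst.
  by apply: cvgM => //; exact: cvg_dirnbhs0.
apply: cvg_trans; apply: near_eq_cvg.
apply: filterS (near_dirnbhs_in D v x) => h [h0 Dh].
by rewrite /diff_quot /= /GRing.scale /= mulrA divff// mul1r addrC subrK.
Qed.

Lemma is_pderivD D v f g x a b : is_pderiv D v f x a -> is_pderiv D v g x b ->
  is_pderiv D v (fun y => f y + g y) x (a + b).
Proof.
move=> fa gb; rewrite /is_pderiv.
rewrite (_ : diff_quot _ _ _ = diff_quot v f x \+ diff_quot v g x).
  exact: cvgD.
by apply/funext => h; rewrite /diff_quot /= -scalerDr addrACA -opprD.
Qed.

Lemma is_pderivM D v f g x a b : is_pderiv D v f x a -> is_pderiv D v g x b ->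
  is_pderiv D v (fun y => f y * g y) x (a * g x + f x * b).
Proof.
move=> fa gb; rewrite /is_pderiv.
rewrite (_ : diff_quot _ _ _ = (fun h => diff_quot v f x h * g (h *: v + x) +
   f x * diff_quot v g x h)).
  apply: cvgD; apply: cvgM => //; [exact: is_pderiv_cvg gb|exact: cvg_cst].
apply/funext => h; rewrite /diff_quot /= /GRing.scale /=; ring.
Qed.

Lemma is_pderivZ D v f x a (c : R) : is_pderiv D v f x a ->
  is_pderiv D v (fun y => c * f y) x (c * a).
Proof.
move=> fa; have := is_pderivM (is_pderiv_cst D v x c) fa.
by rewrite mul0r add0r.
Qed.

Lemma is_pderivN D v f x a : is_pderiv D v f x a ->
  is_pderiv D v (fun y => - f y) x (- a).
Proof.
move=> /(is_pderivZ (c := - 1)); rewrite mulN1r.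
by under eq_fun do rewrite mulN1r.
Qed.

Lemma is_pderivB D v f g x a b : is_pderiv D v f x a -> is_pderiv D v g x b ->
  is_pderiv D v (fun y => f y - g y) x (a - b).
Proof. by move=> fa /is_pderivN; exact: is_pderivD. Qed.

Lemma is_pderivV D v f x a : f x != 0 -> is_pderiv D v f x a ->
  is_pderiv D v (fun y => (f y)^-1) x (- a / f x ^+ 2).
Proof.
move=> f0 fa; have fc := is_pderiv_cvg fa.
have : (fun h => - diff_quot v f x h / (f (h *: v + x) * f x))
   @ dirnbhs D v x --> - a / f x ^+ 2.
  apply: cvgM; first exact: cvgN.
  rewrite expr2; apply: cvgV; first exact: mulf_neq0.
  by apply: cvgM => //; exact: cvg_cst.
apply: cvg_trans; apply: near_eq_cvg.
near=> h.
have h0 : h != 0 by near: h; apply: filterS (near_dirnbhs_in D v x) => ? [].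
have fh0 : f (h *: v + x) != 0.
  near: h; have /cvgrPdist_lt/(_ `|f x|) := fc; rewrite normr_gt0 => /(_ f0).
  by apply: filterS => h; apply: contraTneq => ->; rewrite subr0 ltxx.
rewrite /diff_quot /= /GRing.scale /=; field.
by rewrite h0 f0 fh0.
Unshelve. all: by end_near. Qed.

End RelativeCalculus.

(** * Functions of class C^k relative to a set *)

Section RelativeCk.
Context {R : realType} {U : normedModType R} {J : Type} (b : J -> U).
Implicit Types (D : set U) (f g : U -> R).

Lemma within_continuousP D f : {within D, continuous f} <->
  (forall x, D x -> f @ within D (nbhs x) --> f x).
Proof. exact: subspace_continuousP. Qed.

Lemma within_continuous_ext D f g : {in D, f =1 g} ->
  {within D, continuous f} -> {within D, continuous g}.
Proof.
move=> fg /within_continuousP fc; apply/within_continuousP => x Dx.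
rewrite -fg ?inE//; apply: cvg_trans (fc _ Dx); apply: near_eq_cvg.
suff : (nbhs x) [set y | D y -> f y = g y] by [].
by apply: nearW => y Dy; apply/fg/mem_set.
Qed.

Lemma Ck_continuous D k f : Ck b D k f -> {within D, continuous f}.
Proof. by case: k => [|k] []. Qed.

Lemma CkW D k f : Ck b D k.+1 f -> Ck b D k f.
Proof.
elim: k f => [|k IH] f [fc fD]; first by split.
by split => // j; have [fj Dj] := fD j; split => //; exact: IH.
Qed.

Lemma Ck_le D k k' f : (k <= k')%N -> Ck b D k' f -> Ck b D k f.
Proof.
move=> /subnK <-; elim: (k' - k)%N => // n IH /CkW; exact: IH.
Qed.

Definition accumulating D := forall j x, D x -> adherent D (b j) x.

Lemma Ck_pderiv D k f j x : Ck b D k.+1 f -> D x ->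
  is_pderiv D (b j) f x (pderiv D (b j) f x).
Proof. by move=> [_ /(_ j)[+ _]] => /[apply] /pderivableP. Qed.

Lemma CkS_pderiv D k f j : Ck b D k.+1 f -> Ck b D k (pderiv D (b j) f).
Proof. by move=> [_ /(_ j)[]]. Qed.

Lemma Ck_ext D k f g : accumulating D -> {in D, f =1 g} ->
  Ck b D k f -> Ck b D k g.
Proof.
move=> acc; elim: k f g => [|k IH] f g fg [fc fD].
  by split=> //; exact: within_continuous_ext fc.
split; first exact: within_continuous_ext fc.
move=> j; have [fj Dj] := fD j; split=> [x Dx|].
  by have /pderivableP/(is_pderiv_ext Dx fg)/is_pderiv_pderivable := fj _ Dx.
apply: IH Dj => x /set_mem Dx.
by rewrite (pderiv_ext Dx fg)//; [exact: acc|exact: fj].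
Qed.

(** [pderiv] is uncontrolled outside [D], so regularity is proved for explicit formulas [f'] and
    carried over by [Ck_ext]. *)
Lemma CkS_intro D k f (f' : J -> U -> R) : accumulating D ->
  {within D, continuous f} ->
  (forall j x, D x -> is_pderiv D (b j) f x (f' j x)) ->
  (forall j, Ck b D k (f' j)) -> Ck b D k.+1 f.
Proof.
move=> acc fc ff' f'k; split=> // j; split=> [x Dx|].
  exact: is_pderiv_pderivable (ff' j x Dx).
apply: Ck_ext (f'k j) => // x /set_mem Dx.
by rewrite (pderiv_val _ (ff' j x Dx))//; exact: acc.
Qed.

Lemma Ck_sub D D' k f : accumulating D -> D `<=` D' -> Ck b D' k f -> Ck b D k f.
Proof.
move=> acc DD'; elim: k f => [|k IH] f fk.
  have fc := Ck_continuous fk; split=> //; exact: continuous_subspaceW fc.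
apply: (CkS_intro (f' := fun j => pderiv D' (b j) f)) => //.
- by apply: continuous_subspaceW (Ck_continuous fk).
- by move=> j x Dx; apply: (is_pderiv_sub DD'); apply: Ck_pderiv fk _; exact: DD'.
- by move=> j; apply: IH; exact: CkS_pderiv.
Qed.

Lemma pderiv_sub D D' k f j x : accumulating D -> D `<=` D' ->
  Ck b D' k.+1 f -> D x -> pderiv D (b j) f x = pderiv D' (b j) f x.
Proof.
move=> acc DD' fk Dx; apply: pderiv_val; first exact: acc.
by apply: (is_pderiv_sub DD'); apply: Ck_pderiv fk _; exact: DD'.
Qed.

Lemma CkD D k f g : accumulating D -> Ck b D k f -> Ck b D k g ->
  Ck b D k (fun x => f x + g x).
Proof.
move=> acc.
have CD f1 g1 : {within D, continuous f1} -> {within D, continuous g1} ->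
    {within D, continuous (fun x => f1 x + g1 x)}.
  by move=> fc gc x; apply: cvgD; [exact: fc|exact: gc].
elim: k f g => [|k IH] f g fk gk.
  by split=> //; exact: CD (Ck_continuous fk) (Ck_continuous gk).
apply: (CkS_intro (f' := fun j x => pderiv D (b j) f x + pderiv D (b j) g x)) => //.
- by exact: CD (Ck_continuous fk) (Ck_continuous gk).
- move=> j x Dx.
  exact: is_pderivD (Ck_pderiv (j := j) fk Dx) (Ck_pderiv (j := j) gk Dx).
- by move=> j; exact: IH (CkS_pderiv j fk) (CkS_pderiv j gk).
Qed.

Lemma CkM D k f g : accumulating D -> Ck b D k f -> Ck b D k g ->
  Ck b D k (fun x => f x * g x).
Proof.
move=> acc.
have CM f1 g1 : {within D, continuous f1} -> {within D, continuous g1} ->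
    {within D, continuous (fun x => f1 x * g1 x)}.
  by move=> fc gc x; apply: cvgM; [exact: fc|exact: gc].
elim: k f g => [|k IH] f g fk gk.
  by split=> //; exact: CM (Ck_continuous fk) (Ck_continuous gk).
apply: (CkS_intro (f' := fun j x => pderiv D (b j) f x * g x
  + f x * pderiv D (b j) g x)) => //.
- by exact: CM (Ck_continuous fk) (Ck_continuous gk).
- move=> j x Dx.
  exact: is_pderivM (Ck_pderiv (j := j) fk Dx) (Ck_pderiv (j := j) gk Dx).
- move=> j; apply: CkD => //; apply: IH.
  + exact: CkS_pderiv fk.
  + exact: CkW gk.
  + exact: CkW fk.
  + exact: CkS_pderiv gk.
Qed.

Lemma Ck_cst D k (c : R) : accumulating D -> Ck b D k (cst c).
Proof.
move=> acc; elim: k c => [|k IH] c.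
  by split=> // x; exact: cvg_cst.
apply: (CkS_intro (f' := fun _ => cst 0)) => //.
- by move=> x; exact: cvg_cst.
- by move=> j x Dx; exact: is_pderiv_cst.
Qed.

Lemma CkN D k f : accumulating D -> Ck b D k f -> Ck b D k (fun x => - f x).
Proof.
move=> acc fk; apply: (Ck_ext (f := fun x => cst (- 1) x * f x)) => //.
  by move=> x _; rewrite mulN1r.
by apply: CkM => //; exact: Ck_cst.
Qed.

Lemma CkV D k f : accumulating D -> (forall x, D x -> f x != 0) ->
  Ck b D k f -> Ck b D k (fun x => (f x)^-1).
Proof.
move=> acc f0.
have CV : {within D, continuous f} -> {within D, continuous (fun x => (f x)^-1)}.
  move=> /within_continuousP fc; apply/within_continuousP => x Dx.
  by apply: cvgV; [exact: f0|exact: fc].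
elim: k => [|k IH] fk; first by split=> //; apply: CV; exact: Ck_continuous fk.
(* The square in the denominator is split into two factors 1 / f, to each of which the induction
   hypothesis applies. *)
apply: (CkS_intro (f' := fun j x => (- pderiv D (b j) f x) *
   ((f x)^-1 * (f x)^-1))) => //.
- by apply: CV; exact: Ck_continuous fk.
- move=> j x Dx; have := is_pderivV (f0 _ Dx) (Ck_pderiv (j := j) fk Dx).
  by rewrite expr2 invfM.
- move=> j; apply: CkM => //; first by apply: CkN => //; exact: CkS_pderiv.
  by apply: CkM => //; apply: IH; exact: CkW.
Qed.

End RelativeCk.

(** * Mean value theorems and equality of mixed derivatives *)

Section MeanValue.
Context {R : realType} {U : normedModType R}.
Implicit Types (D : set U) (u v p : U) (f : U -> R).

Lemma is_pderiv_line D v f p (c l : R) : nbhs (c *: v + p) D ->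
  is_pderiv D v f (c *: v + p) l ->
  is_derive c (1 : R) (fun s : R => f (s *: v + p)) l.
Proof.
rewrite /is_pderiv /dirnbhs => nD; rewrite (Defs.within_interior v nD) => fl.
have {}fl : (fun h : R => h^-1 *: (((fun s : R => f (s *: v + p)) \o shift c)
    (h *: (1 : R)) - f (c *: v + p))) @ 0^' --> l.
  rewrite (_ : (fun h : R => _) = diff_quot v f (c *: v + p)) //.
  apply/funext => h; rewrite /diff_quot /=.
  by rewrite [_ *: 1]mulr1 scalerDl addrA.
apply: DeriveDef; first by apply/cvg_ex; exists l.
exact: cvg_lim fl.
Qed.

Lemma MVT_derive (g g' : R -> R) (b : R) : 0 < b ->
  (forall c, 0 <= c <= b -> is_derive c 1 g (g' c)) ->
  exists2 c, 0 < c < b & g b - g 0 = g' c * b.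
Proof.
move=> b0 gg'.
have [||c cb] := @MVT R g g' 0 b b0.
- move=> c; rewrite in_itv /= => /andP[c0 cb]; apply: gg'.
  by rewrite !ltW.
- apply: derivable_within_continuous => c; rewrite in_itv /= => /gg' [].
  by [].
- rewrite subr0 => ->; exists c => //.
Qed.

(** The second difference is the increment in [u] of the difference of [f] across [v]; the mean
    value theorem in [u], and then for [fu] in [v], turns it into a value of [fuv]. *)
Lemma rectangle_MVT D u v f fu fuv p (h : R) : open D -> 0 < h ->
  (forall a b, 0 <= a <= h -> 0 <= b <= h -> D (b *: v + (a *: u + p))) ->
  (forall q, D q -> is_pderiv D u f q (fu q)) ->
  (forall q, D q -> is_pderiv D v fu q (fuv q)) ->
  exists a b, [/\ 0 < a < h, 0 < b < h &
    f (h *: v + (h *: u + p)) - f (h *: v + p) - f (h *: u + p) + f p =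
    fuv (b *: v + (a *: u + p)) * (h * h)].
Proof.
move=> oD h0 Dab ffu fufuv.
have hh : 0 <= h <= h by rewrite lexx ltW.
have h00 : 0 <= (0 : R) <= h by rewrite lexx ltW.
have Dv a : 0 <= a <= h -> D (a *: u + (h *: v + p)).
  by move=> ah; rewrite addrCA; exact: Dab.
have Da a : 0 <= a <= h -> D (a *: u + p).
  by move=> ah; have := Dab _ _ ah h00; rewrite scale0r add0r.
have [|a ah] := @MVT_derive (fun a => f (a *: u + (h *: v + p)) - f (a *: u + p))
  (fun a => fu (a *: u + (h *: v + p)) - fu (a *: u + p)) h h0.
  move=> c ch; apply: is_deriveB; (apply: is_pderiv_line => /=;
    first by apply: open_nbhs_nbhs; split; [exact: oD|
      first [exact: Dv|exact: Da]]); apply: ffu; [exact: Dv|exact: Da].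
have ah' : 0 <= a <= h by case/andP: ah => /ltW -> /ltW ->.
have [|b bh] := @MVT_derive (fun b => fu (b *: v + (a *: u + p)))
  (fun b => fuv (b *: v + (a *: u + p))) h h0.
  move=> c ch; apply: is_pderiv_line.
    by apply: open_nbhs_nbhs; split; [exact: oD|exact: Dab].
  by apply: fufuv; exact: Dab.
rewrite !scale0r !add0r => e1 e2; exists a, b; split => //.
rewrite (addrCA (h *: v)).
move: e2; rewrite (addrCA (a *: u)) e1 => e2.
by rewrite mulrA -e2; ring.
Qed.

(* Schwarz: both iterated derivatives are limits of the same second difference. *)
Lemma pderivC D u v f fu fv fuv fvu p : open D -> D p ->
  (forall q, D q -> is_pderiv D u f q (fu q)) ->
  (forall q, D q -> is_pderiv D v f q (fv q)) ->
  (forall q, D q -> is_pderiv D v fu q (fuv q)) ->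
  (forall q, D q -> is_pderiv D u fv q (fvu q)) ->
  {within D, continuous fuv} -> {within D, continuous fvu} ->
  fuv p = fvu p.
Proof.
move=> oD Dp ffu ffv fufuv fvfvu.
move=> /within_continuousP/(_ p Dp) cuv /within_continuousP/(_ p Dp) cvu.
apply/eqP; rewrite -subr_eq0 -normr_le0; apply/ler_addgt0Pr => e e0.
rewrite add0r.
have e20 : 0 < e / 2 by rewrite divr_gt0.
have nD : nbhs p D by apply: open_nbhs_nbhs.
have : nbhs p [set q | [/\ D q, `|fuv p - fuv q| < e / 2 & `|fvu p - fvu q| < e / 2]].
  have /cvgrPdist_lt/(_ _ e20) := cuv; have /cvgrPdist_lt/(_ _ e20) := cvu.
  rewrite /within /= => n1 n2.
  have {}n1 : nbhs p [set x | D x -> `|fvu p - fvu x| < e / 2] by [].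
  have {}n2 : nbhs p [set x | D x -> `|fuv p - fuv x| < e / 2] by [].
  by apply: filterS3 nD n1 n2 => q Dq q1 q2; split => //; [exact: q2|exact: q1].
move=> /nbhs_ballP[r /= r0 rP].
(* All points a u + b v + p with 0 <= a, b <= h then lie within h (|u| + |v|) < r of [p]. *)
pose h := r / (2 * (`|u| + `|v| + 1)).
have uv0 : 0 < `|u| + `|v| + 1 by rewrite ltr_wpDl// addr_ge0.
have h0 : 0 < h by rewrite divr_gt0// mulr_gt0.
have inb a b : 0 <= a <= h -> 0 <= b <= h -> ball p r (b *: v + (a *: u + p)).
  move=> /andP[a0 ah] /andP[b0 bh]; rewrite -ball_normE /=.
  rewrite !opprD addrCA [X in `|_ + X|]addrCA subrr addr0 -opprD normrN.
  rewrite (le_lt_trans (ler_normD _ _))// !normrZ !ger0_norm//.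
  rewrite (@le_lt_trans _ _ (h * (`|u| + `|v|)))//.
    by rewrite mulrDr addrC lerD// ler_wpM2r.
  have -> : r = h * (2 * (`|u| + `|v| + 1)) by rewrite /h divfK// gt_eqF// mulr_gt0.
  rewrite ltr_pM2l//; have := normr_ge0 u; have := normr_ge0 v; lra.
have inb' a b : 0 <= a <= h -> 0 <= b <= h -> ball p r (a *: u + (b *: v + p)).
  by move=> ah bh; rewrite addrCA; exact: inb.
have [a [b [ah bh E1]]] := @rectangle_MVT D u v f fu fuv p h oD h0
  (fun a b ah bh => let: And3 Dq _ _ := rP _ (inb a b ah bh) in Dq) ffu fufuv.
have [a' [b' [ah' bh' E2]]] := @rectangle_MVT D v u f fv fvu p h oD h0
  (fun a b ah bh => let: And3 Dq _ _ := rP _ (inb' b a bh ah) in Dq) ffv fvfvu.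
(* The second difference is symmetric in [u] and [v], so the two intermediate values coincide; this
   number is within e / 2 of both mixed derivatives at [p]. *)
have : fuv (b *: v + (a *: u + p)) = fvu (b' *: u + (a' *: v + p)).
  apply: (@mulIf _ (h * h)); first by rewrite mulf_neq0// gt_eqF.
  by rewrite -E1 -E2 (addrCA (h *: v)); ring.
have w c : 0 < c < h -> 0 <= c <= h by case/andP => /ltW -> /ltW ->.
have [_ + _] := rP _ (inb _ _ (w _ ah) (w _ bh)).
have [_ _ +] := rP _ (inb' _ _ (w _ bh') (w _ ah')).
move=> + + E; rewrite -E; set x := fuv (_ + _).
rewrite (distrC (fvu p)) => n1 n2.
rewrite -(subrKA x) (le_trans (ler_normD _ _))//; lra.
Qed.

End MeanValue.

(** * Implicit differentiation along vertical lines *)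

Section PairLimits.
Context {R : realType} {d : nat}.

Lemma cvg_to_pair (T : Type) (F : set_system T) (FF : Filter F)
    (f : T -> R) (g : T -> 'rV[R]_d) (a : R) (x : 'rV[R]_d) :
  f @ F --> a -> g @ F --> x -> (fun y => (f y, g y)) @ F --> (a, x).
Proof. by move=> fa gx; exact: cvg_pair fa gx. Qed.

Lemma cvg_nbhs_fst (p : R * 'rV[R]_d) : fst @ nbhs p --> p.1.
Proof. by case: p => a x; exact: cvg_fst. Qed.

Lemma cvg_nbhs_snd (p : R * 'rV[R]_d) : snd @ nbhs p --> p.2.
Proof. by case: p => a x; exact: cvg_snd. Qed.

Lemma cvg_within_fst (W : set (R * 'rV[R]_d)) (p : R * 'rV[R]_d) :
  fst @ within W (nbhs p) --> p.1.
Proof.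
by apply: cvg_trans (@cvg_nbhs_fst p); apply: cvg_app; exact: cvg_within.
Qed.

Lemma cvg_within_snd (W : set (R * 'rV[R]_d)) (p : R * 'rV[R]_d) :
  snd @ within W (nbhs p) --> p.2.
Proof.
by apply: cvg_trans (@cvg_nbhs_snd p); apply: cvg_app; exact: cvg_within.
Qed.

End PairLimits.

(** * The half-cylinder and its vertical segments *)

Section HalfCylinder.
Context {R : realType} {d : nat} (a0 : R) (X : set 'rV[R]_d).
Hypothesis oX : open X.

(** Open, so that relative derivatives are ordinary ones, and containing the segment between any two
    of its points with the same [x]. For a0 = mu'^2 / 2 and X the punctured space it is the interior
    of I x (R^d \ {0}). *)
Definition half_cylinder : set (R * 'rV[R]_d) := [set p | a0 < p.1 /\ X p.2].
Let O := half_cylinder.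

Lemma open_half_cylinder : open O.
Proof.
rewrite (_ : O = [set p | a0 < p.1] `&` (snd @^-1` X)) //.
apply: openI.
  rewrite (_ : [set p | _] = fst @^-1` [set s : R | a0 < s]) //.
  by apply: open_comp => [p _|]; [exact: cvg_fst|exact: open_gt].
by apply: open_comp => [p _|] //; exact: cvg_snd.
Qed.

Lemma vertical_MVT_lt (G Gl : R * 'rV[R]_d -> R) a b x : O (a, x) -> a < b ->
  (forall q, O q -> is_pderiv O sdir G q (Gl q)) ->
  exists2 c, a < c < b & G (b, x) - G (a, x) = Gl (c, x) * (b - a).
Proof.
move=> [/= a0a Xx] ab GGl.
have lineE s : (s *: sdir + (a, x)) = (s + a, x) :> R * 'rV[R]_d.
  by rewrite /sdir; congr pair; [rewrite /= [_ *: 1]mulr1|rewrite /= scaler0 add0r].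
have Os s : 0 <= s -> O (s *: sdir + (a, x)).
  by move=> s0; rewrite lineE; split => //=; rewrite ltr_wpDl.
have ba0 : 0 < b - a by rewrite subr_gt0.
have [c /andP[c0 cb]|c cb E] := @MVT_derive R (fun s => G (s *: sdir + (a, x)))
  (fun s => Gl (s *: sdir + (a, x))) (b - a) ba0.
  apply: is_pderiv_line.
    by apply: open_nbhs_nbhs; split; [exact: open_half_cylinder|exact: Os].
  by apply: GGl; exact: Os.
exists (c + a); first by lra.
by move: E; rewrite !lineE subrK add0r.
Qed.

(** The order of [a] and [b] is left open because the increment of an implicit function has no known
    sign; the bound on [|c - a|] makes [c] tend to [a] together with [b]. *)
Lemma vertical_MVT (G Gl : R * 'rV[R]_d -> R) a b x : O (a, x) -> O (b, x) ->
  (forall q, O q -> is_pderiv O sdir G q (Gl q)) ->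
  exists c, [/\ `|c - a| <= `|b - a|, O (c, x) &
    G (b, x) - G (a, x) = Gl (c, x) * (b - a)].
Proof.
move=> Oa Ob GGl; have [a0a Xx] := Oa; have [a0b _] := Ob.
have [ab|ba|<-] := ltgtP a b.
- have [c /andP[ac cb] E] := vertical_MVT_lt Oa ab GGl.
  exists c; split => //; last by split => //=; rewrite (lt_trans a0a).
  by rewrite !gtr0_norm ?subr_gt0// lerB// ltW.
- have [c /andP[ac cb] E] := vertical_MVT_lt Ob ba GGl.
  exists c; split; last by rewrite -opprB E -mulrN opprB.
    by rewrite !ltr0_norm ?subr_lt0// lerN2 lerB// ltW.
  by split => //=; rewrite (lt_trans a0b).
- by exists a; rewrite !subrr mulr0; split.
Qed.

End HalfCylinder.

Lemma mul_diff_quot {R : realType} {U : normedModType R} (v : U) f x (h : R) :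
  h != 0 -> h * diff_quot v f x h = f (h *: v + x) - f x.
Proof. by move=> h0; rewrite /diff_quot /= /GRing.scale /= mulVKf. Qed.

Lemma horizontal_line {R : realType} {d : nat} (a h : R) (x w : 'rV[R]_d) :
  h *: ((0, w) : R * 'rV[R]_d) + (a, x) = (a, h *: w + x).
Proof. by congr pair; rewrite /= [_ *: 0]mulr0 add0r. Qed.

(** * The substitution p |-> (lam p, p.2) and implicit functions *)

Section Fiber.
Context {R : realType} {d : nat} (a0 : R) (X : set 'rV[R]_d).
Hypothesis oX : open X.
Variables (W : set (R * 'rV[R]_d)) (lam : R * 'rV[R]_d -> R).
Let O := half_cylinder a0 X.
Let phi (p : R * 'rV[R]_d) := (lam p, p.2).
Hypothesis phiO : forall p, W p -> O (phi p).

Lemma cvg_fiber p : W p -> lam @ within W (nbhs p) --> lam p ->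
  phi @ within W (nbhs p) --> within O (nbhs (phi p)).
Proof.
move=> Wp clam.
have cphi : phi @ within W (nbhs p) --> phi p.
  by apply: cvg_to_pair => //; exact: cvg_within_snd.
move=> A; rewrite /within /= => OA.
have : (phi @ within W (nbhs p)) (fun q => O q -> A q) := cphi _ OA.
rewrite /nbhs /= /within /=.
by apply: filterS => q h Wq; apply: h => //; exact: phiO.
Qed.

(** The slope [c h] is [Gl] at a mean value point, which tends to [phi p] because [lam] is
    continuous at [p]. Being always a value of [Gl] on [O], it can be divided by when [Gl] has no
    zero there. *)
Lemma fiber_slope (G Gl : R * 'rV[R]_d -> R) v p : W p ->
  lam @ within W (nbhs p) --> lam p ->
  (forall q, O q -> is_pderiv O sdir G q (Gl q)) -> {within O, continuous Gl} ->
  exists c : R -> R, [/\ c @ dirnbhs W v p --> Gl (phi p),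
    forall h, exists2 q, O q & c h = Gl q &
    forall h, W (h *: v + p) ->
      G (phi (h *: v + p)) - G (lam p, (h *: v + p).2) =
      c h * (lam (h *: v + p) - lam p)].
Proof.
move=> Wp clam GGl cGl; have Op := phiO Wp.
pose P h x := [/\ O (x, (h *: v + p).2), `|x - lam p| <= `|lam (h *: v + p) - lam p| &
   G (phi (h *: v + p)) - G (lam p, (h *: v + p).2) =
      Gl (x, (h *: v + p).2) * (lam (h *: v + p) - lam p)].
have exi h : exists x, W (h *: v + p) -> P h x.
  have [Wh|nW] := pselect (W (h *: v + p)); last by exists 0.
  have Oph := phiO Wh.
  have Opp : O (lam p, (h *: v + p).2) by split; [exact: Op.1|exact: Oph.2].
  have [c [c1 c2 c3]] := vertical_MVT oX Opp Oph GGl.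
  by exists c.
have [xi xiP] := choice exi.
(* When the displaced point leaves [W] the default is the value at [phi p], so that [c h] is a value
   of [Gl] on [O] for every [h]. *)
exists (fun h => if pselect (W (h *: v + p)) then Gl (xi h, (h *: v + p).2)
  else Gl (phi p)); split; last 2 first.
- move=> h; case: pselect => [Wh|nWh]; last by exists (phi p).
  by have [Oh _ _] := xiP _ Wh; exists (xi h, (h *: v + p).2).
- by move=> h Wh; case: pselect => // Wh'; have [] := xiP _ Wh.
have cx : xi @ dirnbhs W v p --> lam p.
  have cl : (fun h => lam (h *: v + p)) @ dirnbhs W v p --> lam p.
    by apply: cvg_comp clam; exact: cvg_dirnbhs_within.
  apply/cvgrPdist_lt => e e0; move/cvgrPdist_lt/(_ _ e0) : cl.
  apply: filterS2 (near_dirnbhs_in W v p) => h [_ Wh].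
  have [_ le_xi _] := xiP _ Wh; rewrite !(distrC (lam p)).
  exact: le_lt_trans.
have cpair : (fun h => (xi h, (h *: v + p).2)) @ dirnbhs W v p -->
    within O (nbhs (phi p)).
  have cc : (fun h => (xi h, (h *: v + p).2)) @ dirnbhs W v p --> phi p.
    apply: cvg_to_pair => //; apply: cvg_comp (@cvg_nbhs_snd _ _ p).
    exact: cvg_dirnbhs.
  move=> A; rewrite /within /= => OA.
  have := cc _ OA; rewrite /nbhs /=.
  apply: filterS2 (near_dirnbhs_in W v p) => h [_ Wh] /=; apply.
  by have [] := xiP _ Wh.
have /within_continuousP/(_ _ Op) cG := cGl.
apply: cvg_trans (cvg_comp _ _ cpair cG).
apply: near_eq_cvg; apply: filterS (near_dirnbhs_in W v p) => h [_ Wh] /=.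
by case: pselect.
Qed.

(** The displaced point keeps the height [lam p] and takes its spatial part from a point of [W], so
    it stays in [O]. *)
Lemma within_horizontal v p : W p ->
  dirnbhs W v p `=>` dirnbhs O (0, v.2) (phi p).
Proof.
move=> Wp A OA.
apply: filterS2 (near_dirnbhs_in W v p)
  (_ : dirnbhs W v p (fun h => O (h *: (0, v.2) + phi p) -> A h)).
  move=> h [h0 Wh]; apply; split => /=; last exact: (phiO Wh).2.
  by rewrite [_ *: 0]mulr0 add0r; exact: (phiO Wp).1.
move: OA; rewrite /dirnbhs /within /=.
by apply: filterS => h hA _; exact: hA.
Qed.

(** The increment passes through the point with the old height [lam p] and the new spatial part: the
    vertical step has the slope of [fiber_slope], the other is a plain difference quotient. Joint
    differentiability of [G] is never invoked. *)
Lemma is_pderiv_fiber (G Gl : R * 'rV[R]_d -> R) v p l g2 : W p ->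
  lam @ within W (nbhs p) --> lam p ->
  (forall q, O q -> is_pderiv O sdir G q (Gl q)) -> {within O, continuous Gl} ->
  is_pderiv W v lam p l -> is_pderiv O (0, v.2) G (phi p) g2 ->
  is_pderiv W v (fun q => G (phi q)) p (Gl (phi p) * l + g2).
Proof.
move=> Wp clam GGl cGl laml Gg2.
have [c [cc _ cE]] := fiber_slope v Wp clam GGl cGl.
apply: (@is_pderiv_near _ _ _ _ _ _ _
  (fun h => c h * diff_quot v lam p h + diff_quot (0, v.2) G (phi p) h)).
  move=> h h0 Wh; rewrite mulrDr mulrCA !mul_diff_quot// -cE//.
  by rewrite horizontal_line subrKA.
apply: cvgD; first exact: cvgM.
by apply: cvg_trans Gg2; apply: cvg_app; exact: within_horizontal.
Qed.

(** The same splitting of [T (phi q) = q.1], solved for the difference quotient of [lam] before the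
    limit is taken; only continuity of [lam] at [p] is presupposed. *)
Lemma is_pderiv_implicit (T Tl : R * 'rV[R]_d -> R) v p g2 : W p ->
  lam @ within W (nbhs p) --> lam p ->
  (forall q, O q -> is_pderiv O sdir T q (Tl q)) -> {within O, continuous Tl} ->
  (forall q, O q -> Tl q != 0) -> (forall q, W q -> T (phi q) = q.1) ->
  is_pderiv O (0, v.2) T (phi p) g2 ->
  is_pderiv W v lam p ((v.1 - g2) / Tl (phi p)).
Proof.
move=> Wp clam TTl cTl Tl0 Tphi Tg2.
have [c [cc cO cE]] := fiber_slope v Wp clam TTl cTl.
have c0 h : c h != 0 by have [q Oq ->] := cO h; exact: Tl0.
apply: (@is_pderiv_near _ _ _ _ _ _ _
  (fun h => (v.1 - diff_quot (0, v.2) T (phi p) h) / c h)).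
  move=> h h0 Wh; apply: (mulfI (c0 h)); rewrite -cE// Tphi//.
  rewrite [RHS]mulrCA [c h * _]mulrC divfK//.
  rewrite mulrBr mul_diff_quot// horizontal_line Tphi//.
  rewrite (_ : (h *: v + p).1 = (h : R) * v.1 + p.1) //=.
  by rewrite opprB [RHS]addrA addrAC -!addrA [X in _ + X]addrC.
apply: cvgM; last by apply: cvgV => //; exact: Tl0 (phiO Wp).
apply: cvgB; first exact: cvg_cst.
by apply: cvg_trans Tg2; apply: cvg_app; exact: within_horizontal.
Qed.

(** [T] decreases strictly in the height, so T (s1, x) > t > T (s2, x) for s1 < lam p < s2, where p
    = (t, x). These inequalities persist near [p] in [W] and trap [lam] between s1 and s2. *)
Lemma fiber_continuous (T Tl : R * 'rV[R]_d -> R) p : W p ->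
  {within O, continuous T} ->
  (forall q, O q -> is_pderiv O sdir T q (Tl q)) ->
  (forall q, O q -> Tl q < 0) -> (forall q, W q -> T (phi q) = q.1) ->
  lam @ within W (nbhs p) --> lam p.
Proof.
move=> Wp cT TTl Tl0 Tphi; have [a0p Xp] := phiO Wp.
have Tdecr a b x : O (a, x) -> a < b -> T (b, x) < T (a, x).
  move=> Oa ab; have [c /andP[ac _] E] := vertical_MVT_lt oX Oa ab TTl.
  rewrite -subr_lt0 E nmulr_rlt0 ?subr_gt0//.
  by apply: Tl0; split => /=; [rewrite (lt_trans _ ac)//; exact: Oa.1|exact: Oa.2].
have Tle a b x : O (a, x) -> a <= b -> T (b, x) <= T (a, x).
  by move=> Oa; rewrite le_eqVlt => /predU1P[->//|/(Tdecr _ _ _ Oa)/ltW].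
have cslice s : a0 < s ->
    (fun q => T (s, q.2) - q.1) @ within W (nbhs p) --> T (s, p.2) - p.1.
  move=> a0s; apply: cvgB; last first.
    exact: cvg_within_fst.
  have /within_continuousP/(_ (s, p.2) (conj a0s Xp)) := cT.
  apply: cvg_comp.
  have cc : (fun q : R * 'rV[R]_d => (s, q.2)) @ within W (nbhs p) --> (s, p.2).
    by apply: cvg_to_pair; [exact: cvg_cst|exact: cvg_within_snd].
  move=> A; rewrite /within /= => OA.
  have := cc _ OA; rewrite /nbhs /= /within /=.
  by apply: filterS => q h Wq; apply: h => //; split => //; exact: (phiO Wq).2.
apply/cvgrPdist_lt => e e0.
(* The second entry keeps [s1] above [a0], the bottom of the half-cylinder. *)
pose s1 := Num.max (lam p - e / 2) ((lam p + a0) / 2).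
pose s2 := lam p + e / 2.
have a0s1 : a0 < s1 by rewrite /s1 lt_max; apply/orP; right; move: a0p => /=; lra.
have s1p : s1 < lam p by rewrite /s1 gt_max; apply/andP; move: a0p => /=; split; lra.
have s1e : lam p - e / 2 <= s1 by rewrite /s1 le_max lexx.
have ps2 : lam p < s2 by rewrite /s2; lra.
have a0s2 : a0 < s2 by rewrite (lt_trans _ ps2).
have T1 : 0 < T (s1, p.2) - p.1 by rewrite subr_gt0 -Tphi// Tdecr.
have T2 : T (s2, p.2) - p.1 < 0 by rewrite subr_lt0 -[ltRHS]Tphi// Tdecr.
have n1 := cslice _ a0s1 _ (open_nbhs_nbhs (conj (open_gt (y := 0)) T1)).
have n2 := cslice _ a0s2 _ (open_nbhs_nbhs (conj (open_lt (y := 0)) T2)).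
move: n1 n2; rewrite /nbhs /= /within /=.
apply: filterS2 => q n1 n2 Wq.
have Oq := phiO Wq.
have l1 : s1 < lam q.
  rewrite ltNge; apply/negP => /(Tle _ _ q.2 Oq).
  by rewrite Tphi// leNgt -subr_gt0 n1.
have l2 : lam q < s2.
  rewrite ltNge; apply/negP => /(Tle _ _ q.2 (conj a0s2 Oq.2)).
  by rewrite Tphi// leNgt -subr_lt0 n2.
by rewrite ltr_norml; apply/andP; rewrite /s2 in l2 *; split; lra.
Qed.

Hypothesis accW : accumulating sxdir W.
Hypothesis accO : accumulating sxdir O.

Definition dtime (j : option 'I_d) : R := if j is None then 1 else 0.

Lemma sxdir1 j : (sxdir j : R * 'rV[R]_d).1 = dtime j. Proof. by case: j. Qed.

(** Derivative along the spatial part of [sxdir j], which is the zero vector for the scalar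
    direction. *)
Definition xpart (G : option 'I_d -> R * 'rV[R]_d -> R) j : R * 'rV[R]_d -> R :=
  if j is Some i then G (Some i) else cst 0.

Lemma is_pderiv_xpart k G j q : Ck sxdir O k.+1 G -> O q ->
  is_pderiv O (0, (sxdir j).2) G q (xpart (fun j => pderiv O (sxdir j) G) j q).
Proof.
case: j => [i|] Gk Oq /=; last exact: is_pderiv0.
exact: (Ck_pderiv (j := Some i) Gk Oq).
Qed.

Lemma xpart_Ck k G j : Ck sxdir O k.+1 G ->
  Ck sxdir O k (xpart (fun j => pderiv O (sxdir j) G) j).
Proof.
by case: j => [i|] Gk /=; [exact: CkS_pderiv (Some i) Gk|exact: Ck_cst].
Qed.

Lemma Ck_fiber_pderiv k G j p : Ck sxdir O k.+1 G -> Ck sxdir W k.+1 lam -> W p ->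
  is_pderiv W (sxdir j) (fun q => G (phi q)) p
    (pderiv O sdir G (phi p) * pderiv W (sxdir j) lam p +
     xpart (fun j => pderiv O (sxdir j) G) j (phi p)).
Proof.
move=> Gk lamk Wp; apply: is_pderiv_fiber => //.
- by move/within_continuousP : (Ck_continuous lamk); exact.
- by move=> q Oq; exact: (Ck_pderiv (j := None) Gk Oq).
- exact: Ck_continuous (CkS_pderiv None Gk).
- exact: Ck_pderiv lamk Wp.
- by apply: is_pderiv_xpart Gk _; exact: phiO.
Qed.

Lemma Ck_fiber k G : Ck sxdir O k G -> Ck sxdir W k lam ->
  Ck sxdir W k (fun q => G (phi q)).
Proof.
have C0 G1 k1 k2 : Ck sxdir O k1 G1 -> Ck sxdir W k2 lam ->
    {within W, continuous (fun q => G1 (phi q))}.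
  move=> /Ck_continuous/within_continuousP cG /Ck_continuous/within_continuousP cl.
  apply/within_continuousP => p Wp; apply: cvg_comp (cG _ (phiO Wp)).
  by apply: cvg_fiber => //; exact: cl.
elim: k G => [|k IH] G Gk lamk; first by split=> //; exact: C0 Gk lamk.
apply: CkS_intro => //; [exact: C0 Gk lamk|move=> j x; exact: Ck_fiber_pderiv Gk lamk|].
move=> j; apply: CkD => //; last by apply: (IH _ _ (CkW lamk)); exact: xpart_Ck.
apply: CkM => //; last exact: CkS_pderiv.
by apply: (IH _ (CkS_pderiv None Gk)); exact: CkW.
Qed.

Lemma Ck_implicit_pderiv k T j p : Ck sxdir O k.+1 T ->
  (forall q, O q -> pderiv O sdir T q < 0) -> (forall q, W q -> T (phi q) = q.1) ->
  W p -> is_pderiv W (sxdir j) lam p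
    ((dtime j - xpart (fun j => pderiv O (sxdir j) T) j (phi p)) /
      pderiv O sdir T (phi p)).
Proof.
move=> Tk Tl0 Tphi Wp; rewrite -sxdir1.
have TTl q : O q -> is_pderiv O sdir T q (pderiv O sdir T q).
  by move=> Oq; exact: (Ck_pderiv (j := None) Tk Oq).
apply: (@is_pderiv_implicit T) => //.
- exact: fiber_continuous Wp (Ck_continuous Tk) TTl Tl0 Tphi.
- exact: Ck_continuous (CkS_pderiv None Tk).
- by move=> q Oq; rewrite lt_eqF// Tl0.
- by apply: is_pderiv_xpart Tk _; exact: phiO.
Qed.

Lemma Ck_implicit k T : Ck sxdir O k.+1 T ->
  (forall q, O q -> pderiv O sdir T q < 0) -> (forall q, W q -> T (phi q) = q.1) ->
  Ck sxdir W k.+1 lam.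
Proof.
move=> Tk Tl0 Tphi.
have cl : {within W, continuous lam}.
  apply/within_continuousP => p Wp.
  apply: fiber_continuous Wp (Ck_continuous Tk) _ Tl0 Tphi => q Oq.
  exact: (Ck_pderiv (j := None) Tk Oq).
have step n : (n <= k)%N -> Ck sxdir W n lam -> Ck sxdir W n.+1 lam.
  move=> nk lamn; have Tn := Ck_le (ltnW (nk : n.+1 <= k.+1)%N) Tk.
  have {}Tn := Ck_le (nk : n.+1 <= k.+1)%N Tk.
  apply: CkS_intro => //; first by move=> j p; exact: Ck_implicit_pderiv Tn Tl0 Tphi.
  move=> j; apply: CkM => //.
    apply: CkD => //; first exact: Ck_cst.
    by apply: CkN => //; apply: Ck_fiber => //; exact: xpart_Ck.
  apply: CkV => //; first by move=> p Wp; rewrite lt_eqF// Tl0//; exact: phiO.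
  by apply: Ck_fiber => //; exact: (CkS_pderiv None Tn).
have : forall n, (n <= k.+1)%N -> Ck sxdir W n lam; last exact.
by elim=> [|n IH] nk; [split|apply: step => //; apply: IH; exact: ltnW].
Qed.

End Fiber.

(** * Concrete derivatives and multi-indices *)

Section EuclideanNorm.
Context {R : realType} {d : nat}.
Implicit Types x : 'rV[R]_d.

Lemma enorm_ge0 x : 0 <= enorm x. Proof. exact: sqrtr_ge0. Qed.

Lemma sqr_enorm x : enorm x ^+ 2 = \sum_(i < d) x 0 i ^+ 2.
Proof. by rewrite sqr_sqrtr// sumr_ge0// => i _; exact: sqr_ge0. Qed.

Lemma enorm_gt0 x : (0 < enorm x) = (x != 0).
Proof.
rewrite lt_neqAle enorm_ge0 andbT eq_sym; congr (~~ _).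
apply/eqP/eqP => [x0|->].
  apply/rowP => i; rewrite mxE; apply/eqP.
  have := sqr_enorm x; rewrite x0 expr0n /= => /esym/eqP.
  rewrite psumr_eq0; last by move=> j _; exact: sqr_ge0.
  by move=> /allP/(_ i); rewrite mem_index_enum sqrf_eq0 => /(_ isT).
by rewrite /enorm big1 ?sqrtr0// => i _; rewrite mxE expr0n.
Qed.

Lemma coord_le_enorm x i : `|x 0 i| <= enorm x.
Proof.
rewrite -(ler_pXn2r (n := 2)) ?nnegrE ?enorm_ge0//.
rewrite real_normK ?num_real// sqr_enorm (bigD1 i)//= lerDl sumr_ge0// => j _.
exact: sqr_ge0.
Qed.

Lemma jap_gt0 x : 0 < jap x.
Proof. by rewrite sqrtr_gt0 ltr_pwDl// sqr_ge0. Qed.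

Lemma sqr_jap x : jap x ^+ 2 = 1 + enorm x ^+ 2.
Proof. by rewrite sqr_sqrtr// addr_ge0// sqr_ge0. Qed.

Lemma enorm_le_jap x : enorm x <= jap x.
Proof.
rewrite -(ler_pXn2r (n := 2)) ?nnegrE ?enorm_ge0 ?(ltW (jap_gt0 x))//.
by rewrite sqr_jap lerDr.
Qed.

Lemma jap_le_enorm x : 1 <= enorm x -> jap x <= 2 * enorm x.
Proof.
move=> x1.
rewrite -(ler_pXn2r (n := 2)) ?nnegrE ?mulr_ge0 ?enorm_ge0 ?(ltW (jap_gt0 x))//.
by rewrite sqr_jap; nra.
Qed.

Lemma sqr_enorm_line (h : R) i x :
  enorm (h *: evec i + x) ^+ 2 = enorm x ^+ 2 + h * (2 * x 0 i + h).
Proof.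
rewrite !sqr_enorm (bigD1 i)//= [X in _ = X + _](bigD1 i)//=.
rewrite (eq_bigr (fun j => x 0 j ^+ 2)) => [|j /negPf ji].
  by rewrite !mxE !eqxx mulr1; ring.
by rewrite !mxE eqxx ji mulr0 add0r.
Qed.

Lemma enorm_continuous : continuous (@enorm R d).
Proof.
have sumc (r : seq 'I_d) : continuous (fun x : 'rV[R]_d => \sum_(i <- r) x 0 i ^+ 2).
  elim: r => [|i r IH] x.
    by under eq_fun do rewrite big_nil; apply: cst_continuous.
  have -> : (fun x : 'rV[R]_d => \sum_(j <- i :: r) x 0 j ^+ 2) =
      (fun x => x 0 i * x 0 i) \+ (fun x => \sum_(j <- r) x 0 j ^+ 2).
    by apply/funext => y; rewrite big_cons.
  have ci := @coord_continuous R 1 d 0 i x.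
  exact (cvgD (cvgM ci ci) (IH x)).
move=> x; apply: (cvg_comp (fun x : 'rV[R]_d => \sum_(i < d) x 0 i ^+ 2)
  (@Num.sqrt R)); [exact: sumc|exact: sqrt_continuous].
Qed.

Lemma open_row_neq0 : open [set x : 'rV[R]_d | x != 0].
Proof.
rewrite (_ : [set x | _] = ~` [set 0]).
  rewrite openC; apply: accessible_closed_set1.
  exact/hausdorff_accessible/norm_hausdorff.
by apply/seteqP; split => x /= /eqP.
Qed.

End EuclideanNorm.

Lemma adherent_open {R : realType} {U : normedModType R} (D : set U) v x :
  open D -> D x -> adherent D v x.
Proof.
move=> oD Dx e e0; have nD : nbhs x D by exact: open_nbhs_nbhs.
have P0 : ProperFilter (dirnbhs (setT : set U) v x).
  apply: dirnbhs_proper => r r0; exists (r / 2).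
  by rewrite gt_eqF ?divr_gt0// ger0_norm ?divr_ge0 ?ltW//; split => //; lra.
have n1 : dirnbhs (setT : set U) v x (fun h => D (h *: v + x)).
  exact: (@cvg_dirnbhs _ _ setT v x _ nD).
have n2 : dirnbhs (setT : set U) v x (fun h => h != 0 /\ `|h| < e).
  by apply: near_dirnbhs; exists e.
have [h [Dh [h0 he]]] := filter_ex (filterI n1 n2).
by exists h.
Qed.

Section ConcreteDerivatives.
Context {R : realType} {d : nat}.
Implicit Types (D : set (R * 'rV[R]_d)) (p : R * 'rV[R]_d).

(** The difference of the square roots is rationalized; the sum in the denominator is positive as
    soon as [f] is at the base point. *)
Lemma is_pderiv_sqrt {U : normedModType R} (D : set U) v (f : U -> R) x a :
  (forall y, D y -> 0 <= f y) -> 0 < f x -> is_pderiv D v f x a ->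
  is_pderiv D v (fun y => Num.sqrt (f y)) x (a / (2 * Num.sqrt (f x))).
Proof.
move=> f0 fx0 fa; have sx0 : 0 < Num.sqrt (f x) by rewrite sqrtr_gt0.
apply: (@is_pderiv_near _ _ _ _ _ _ _ (fun h => diff_quot v f x h /
   (Num.sqrt (f (h *: v + x)) + Num.sqrt (f x)))).
  move=> h h0 Dh; rewrite mulrA mul_diff_quot//.
  have s0 : 0 < Num.sqrt (f (h *: v + x)) + Num.sqrt (f x).
    by rewrite ltr_wpDl// sqrtr_ge0.
  apply/(mulIf (lt0r_neq0 s0)); rewrite divfK ?gt_eqF//.
  rewrite -subr_sqr !sqr_sqrtr//; first exact: ltW.
  exact: f0.
apply: cvgM => //; apply: cvgV; first by rewrite mulf_neq0// gt_eqF.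
rewrite mulr_natl mulr2n; apply: cvgD; last exact: cvg_cst.
apply: (cvg_comp (fun h => f (h *: v + x)) Num.sqrt); first exact: is_pderiv_cvg fa.
exact: sqrt_continuous.
Qed.

Lemma is_pderiv_fst D j p : is_pderiv D (sxdir j) fst p (dtime j).
Proof.
apply: (@is_pderiv_near _ _ _ _ _ _ _ (fun=> dtime j)); last exact: cvg_cst.
by move=> h h0 Dh; rewrite /= sxdir1 addrK.
Qed.

Lemma is_pderiv_coord D v p i :
  is_pderiv D v (fun q : R * 'rV[R]_d => q.2 0 i) p (v.2 0 i).
Proof.
apply: (@is_pderiv_near _ _ _ _ _ _ _ (fun=> v.2 0 i)); last exact: cvg_cst.
by move=> h h0 Dh; rewrite /= !mxE addrK.
Qed.

Lemma is_pderiv_snd D (f : 'rV[R]_d -> R) p :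
  is_pderiv D sdir (fun q : R * 'rV[R]_d => f q.2) p 0.
Proof.
apply: (@is_pderiv_near _ _ _ _ _ _ _ (fun=> 0)); last exact: cvg_cst.
by move=> h h0 Dh; rewrite /= scaler0 add0r subrr mulr0.
Qed.

Lemma is_pderiv_fun_fst D (f : R -> R) i p :
  is_pderiv D (xdir i) (fun q : R * 'rV[R]_d => f q.1) p 0.
Proof.
apply: (@is_pderiv_near _ _ _ _ _ _ _ (fun=> 0)); last exact: cvg_cst.
by move=> h h0 Dh; rewrite /= [_ *: 0]mulr0 add0r subrr mulr0.
Qed.

Lemma is_pderiv_sqr_enorm D i p :
  is_pderiv D (xdir i) (fun q : R * 'rV[R]_d => enorm q.2 ^+ 2) p (2 * p.2 0 i).
Proof.
apply: (@is_pderiv_near _ _ _ _ _ _ _ (fun h => 2 * p.2 0 i + h)).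
  by move=> h h0 Dh; rewrite [_.2]/(h *: evec i + p.2) sqr_enorm_line addrC addKr.
rewrite -[X in _ --> X]addr0; apply: cvgD; [exact: cvg_cst|exact: cvg_dirnbhs0].
Qed.

Lemma is_pderiv_enorm D i p : p.2 != 0 ->
  is_pderiv D (xdir i) (fun q : R * 'rV[R]_d => enorm q.2) p
    (p.2 0 i / enorm p.2).
Proof.
rewrite -enorm_gt0 => p0.
have := is_pderiv_sqrt (D := D) (v := xdir i) _ _ (@is_pderiv_sqr_enorm D i p).
rewrite (_ : (fun y => _) = (fun q : R * 'rV[R]_d => enorm q.2)); last first.
  by apply/funext => q; rewrite sqrtr_sqr ger0_norm// enorm_ge0.
rewrite sqrtr_sqr ger0_norm ?enorm_ge0// -mulf_div divff ?mul1r; last by [].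
by apply => [y _|]; rewrite ?sqr_ge0// exprn_gt0.
Qed.

Lemma is_pderiv_sqrt2 D p : (forall q, D q -> 0 <= q.1) -> 0 < p.1 ->
  is_pderiv D sdir (fun q : R * 'rV[R]_d => Num.sqrt (2 * q.1)) p
    (Num.sqrt (2 * p.1))^-1.
Proof.
move=> D0 p0; have s0 : 0 < Num.sqrt (2 * p.1) by rewrite sqrtr_gt0 mulr_gt0.
have := is_pderivZ (c := 2) (@is_pderiv_fst D None p); rewrite mulr1.
move=> /(is_pderiv_sqrt _ _) /=.
have -> : 2 / (2 * Num.sqrt (2 * p.1)) = (Num.sqrt (2 * p.1))^-1.
  by field; rewrite gt_eqF.
by apply => [q /D0 q0|]; rewrite ?mulr_ge0 ?mulr_gt0.
Qed.

End ConcreteDerivatives.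

(** * Multi-indices as lists of directions *)

Section MultiIndex.
Context {R : realType} {U : normedModType R}.

(* The directions of a multi-index derivative, the outermost one first. *)
Definition index_list n (alpha : 'I_n -> nat) : seq 'I_n :=
  flatten [seq nseq (alpha i) i | i <- enum 'I_n].

Definition iterated_pderiv (J : Type) (b : J -> U) (D : set U) (f : U -> R)
    (js : seq J) : U -> R :=
  foldr (fun j => pderiv D (b j)) f js.

Lemma iterated_pderiv_nseq (J : Type) (b : J -> U) D f j k js :
  iterated_pderiv b D f (nseq k j ++ js) =
  iter k (pderiv D (b j)) (iterated_pderiv b D f js).
Proof. by elim: k => //= k <-. Qed.

(** On lists, the case distinction for multi-indices of order at most two becomes one on lists with
    at most two entries. *)
Lemma multi_pderivE n (b : 'I_n -> U) D alpha f :
  multi_pderiv b D alpha f = iterated_pderiv b D f (index_list alpha).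
Proof.
rewrite /multi_pderiv /index_list; elim: (enum 'I_n) => //= i s ->.
by rewrite iterated_pderiv_nseq.
Qed.

Lemma size_index_list n (alpha : 'I_n -> nat) :
  size (index_list alpha) = multi_order alpha.
Proof.
rewrite /index_list size_flatten /shape -map_comp sumnE big_map big_enum /=.
by apply: eq_bigr => i _; rewrite size_nseq.
Qed.

Lemma index_list0 n : index_list (fun _ : 'I_n => 0%N) = [::].
Proof. by apply/size0nil; rewrite size_index_list /multi_order big1. Qed.

Lemma index_list1 n (i : 'I_n) : index_list (fun j => nat_of_bool (j == i)) = [:: i].
Proof.
have -> : index_list (fun j => nat_of_bool (j == i)) =
    seq.filter (pred1 i) (enum 'I_n).
  rewrite /index_list; elim: (enum 'I_n) => //= j s ->.
  by case: eqVneq.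
by rewrite filter_pred1_uniq ?enum_uniq ?mem_enum.
Qed.

Variables (J : Type) (b : J -> U).

Lemma Ck_iterated_pderiv D k f js :
  Ck b D (size js + k) f -> Ck b D k (iterated_pderiv b D f js).
Proof.
elim: js k => //= j js IH k fk; apply: CkS_pderiv; apply: IH.
by rewrite addnS.
Qed.

Lemma iterated_pderiv_sub D D' f js : accumulating b D -> D `<=` D' ->
  Ck b D' (size js) f ->
  {in D, iterated_pderiv b D f js =1 iterated_pderiv b D' f js}.
Proof.
move=> acc DD'; elim: js => //= j js IH fk x /set_mem Dx.
have fk1 : Ck b D' 1 (iterated_pderiv b D' f js).
  by apply: Ck_iterated_pderiv; rewrite addn1.
have E := IH (CkW fk).
have E' : {in D, iterated_pderiv b D' f js =1 iterated_pderiv b D f js}.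
  by move=> y yD; rewrite E.
rewrite -(pderiv_sub j acc DD' fk1 Dx); apply: (pderiv_ext Dx E') => //.
  exact: acc.
exact: (is_pderiv_pderivable (Ck_pderiv (j := j) (Ck_sub acc DD' fk1) Dx)).
Qed.

End MultiIndex.

Lemma mixed_pderivE {R : realType} {d : nat} (D : set (R * 'rV[R]_d)) k alpha f :
  mixed_pderiv D k alpha f = iterated_pderiv sxdir D f
    (nseq k None ++ map Some (index_list alpha)).
Proof.
rewrite iterated_pderiv_nseq /mixed_pderiv multi_pderivE; congr iter.
by rewrite /iterated_pderiv foldr_map.
Qed.

(** Near a point of the open set [B] the difference quotients see only zeros of [f], even at
    boundary points of [D]. Applied to s on |x| < R, up to the end point of I. *)
Lemma iterated_pderiv_eq0 {R : realType} {U : normedModType R} {J : Type}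
    (b : J -> U) (D B : set U) f js : accumulating b D -> open B ->
  (forall x, D x -> B x -> f x = 0) ->
  forall x, D x -> B x -> iterated_pderiv b D f js x = 0.
Proof.
move=> acc oB f0; elim: js => //= j js IH x Dx Bx.
apply: pderiv_val; first exact: acc.
have cst0 : is_pderiv D (b j) (cst 0 : U -> R) x 0 := is_pderiv_cst D (b j) x 0.
apply: cvg_trans cst0; apply: near_eq_cvg.
have nB : dirnbhs D (b j) x (fun h => B (h *: b j + x)).
  exact: (@cvg_dirnbhs _ _ D (b j) x _ (open_nbhs_nbhs (conj oB Bx))).
apply: filterS2 nB (near_dirnbhs_in D (b j) x) => h Bh [_ Dh].
by rewrite /diff_quot /= !IH.
Qed.

Lemma powR_unbounded {R : realType} (e B : R) : 0 < e -> 0 <= B ->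
  forall r, B `^ e^-1 <= r -> B <= r `^ e.
Proof.
move=> e0 B0 r Br.
have -> : B = (B `^ e^-1) `^ e by rewrite -powRrM mulVf ?gt_eqF// powRr1.
apply: (ge0_ler_powR (ltW e0)) => //; rewrite nnegrE ?powR_ge0//.
exact: le_trans (powR_ge0 _ _) Br.
Qed.

(** * Perturbation estimates and derivatives of the phase *)

Section Perturbation.
Context {R : realFieldType}.
Implicit Types a b x y z : R.

Lemma close_mul a b x x' y y' : `|x - y| <= a -> `|x' - y'| <= b ->
  `|y| <= 1 -> `|y'| <= 1 -> `|x * x' - y * y'| <= a + b + a * b.
Proof.
move=> xy xy' y1 y1'.
have -> : x * x' - y * y' = (x - y) * y' + y * (x' - y') + (x - y) * (x' - y').
  by ring.
rewrite (le_trans (ler_normD _ _))// lerD//; last first.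
  by rewrite normrM ler_pM.
rewrite (le_trans (ler_normD _ _))// !normrM lerD//.
  by rewrite -[a]mulr1 ler_pM.
by rewrite -[b]mul1r ler_pM.
Qed.

Lemma close_div a b x y z : `|x - y| <= a -> `|z - 1| <= b -> b <= 1 / 2 ->
  `|y| <= 1 -> `|x / z - y| <= 2 * (a + b).
Proof.
move=> xy z1 b2 y1.
have z2 : 1 / 2 <= z by move: z1; rewrite ler_norml => /andP[? _]; lra.
have z0 : 0 < z by lra.
have -> : x / z - y = (x - y - y * (z - 1)) / z by field; rewrite gt_eqF.
rewrite normrM normfV (ger0_norm (ltW z0)) ler_pdivrMr//.
have xyz : `|x - y - y * (z - 1)| <= a + b.
  rewrite (le_trans (ler_normB _ _))// lerD// normrM -[b]mul1r ler_pM//.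
have ab0 : 0 <= a + b by rewrite (le_trans _ xyz).
nra.
Qed.

Variables (M A B C : R).
Hypotheses (M0 : 0 <= M) (M16 : M <= 1 / 16).
Hypotheses (AM : `|A| <= M) (BM : `|B| <= M) (CM : `|C| <= M).
(** The letters stand for dimensionless quantities at a point (lambda, x): A = s, B = w^2 d_lambda
    s, C = w^4 d_lambda^2 s, and below u = x_i / |x|, P = |x| d_i s, Q = w^2 |x| d_lambda d_i s, H =
    |x|^2 d_i d_j s. Then [E1] and [E2] are the factors 1 + e and 1 + e'. *)
Let E1 := 1 + A + B.
Let E2 := 1 + A - 2 * B - C.

(** Absorbs every quadratic error into a linear one; this and the lower bounds 1/2 for [E1] and [E2]
    are what the threshold 1/16 serves. *)
Let sq : M * M <= M / 16.
Proof. by rewrite ler_wpM2l// -[leRHS]mul1r. Qed.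

Lemma close_E1 : `|E1 - 1| <= 2 * M.
Proof.
move: AM BM; rewrite /E1 !ler_norml => /andP[? ?] /andP[? ?].
by apply/andP; split; move: M0 M16; lra.
Qed.

Lemma close_E2 : `|E2 - 1| <= 4 * M.
Proof.
move: AM BM CM; rewrite /E2 !ler_norml => /andP[? ?] /andP[? ?] /andP[? ?].
by apply/andP; split; move: M0 M16; lra.
Qed.

Lemma E1_ge : 1 / 2 <= E1.
Proof. by move: close_E1; rewrite ler_norml => /andP[? ?]; move: M0 M16; lra. Qed.

Lemma E2_ge : 1 / 2 <= E2.
Proof. by move: close_E2; rewrite ler_norml => /andP[? ?]; move: M0 M16; lra. Qed.

Lemma close_sqrE1 : `|E1 ^+ 2 - 1| <= 5 * M.
Proof.
rewrite expr2 -[X in _ - X](mulr1 1).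
apply: le_trans (close_mul close_E1 close_E1 _ _) _; rewrite ?normr1//.
by have := sq; move: M0 M16; lra.
Qed.

(** The terms linear in [B] cancel: a displacement of the critical point changes the critical value
    only to second order. Times |x|^2 / (2 t), the expression is K - |x|^2 / (2 t). *)
Lemma close_phase : `|2 * A + 2 * (A + B) * A - (A + B) ^+ 2| <= 4 * M.
Proof.
have -> : 2 * A + 2 * (A + B) * A - (A + B) ^+ 2 = 2 * A + A * A - B * B by ring.
have a2 : `|A * A| <= M / 16 by rewrite normrM (le_trans _ sq)// ler_pM.
have b2 : `|B * B| <= M / 16 by rewrite normrM (le_trans _ sq)// ler_pM.
move: AM a2 b2; rewrite !ler_norml => /andP[? ?] /andP[? ?] /andP[? ?].
by apply/andP; split; move: M0 M16; lra.
Qed.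

(** The quotient is d_t^2 K divided by its free value |x|^2 / t^3. *)
Lemma close_tt : `|E1 ^+ 3 / E2 - 1| <= 24 * M.
Proof.
have c3 : `|E1 ^+ 3 - 1| <= 8 * M.
  rewrite exprS -[X in _ - X](mulr1 1).
  apply: le_trans (close_mul close_E1 close_sqrE1 _ _) _; rewrite ?normr1//.
  by have := sq; move: M0 M16; lra.
apply: le_trans (close_div c3 close_E2 _ _) _; rewrite ?normr1//; move: M0 M16; lra.
Qed.

Variables (u P Q : R).
Hypotheses (u1 : `|u| <= 1) (PM : `|P| <= M) (QM : `|Q| <= M).

Lemma close_x : `|E1 * (u * (1 + A) + P) - u| <= 5 * M.
Proof.
have c1 : `|u * (1 + A) + P - u| <= 2 * M.
  have -> : u * (1 + A) + P - u = u * A + P by ring.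
  rewrite (le_trans (ler_normD _ _))// mulr_natl mulr2n lerD//.
  by rewrite normrM -[M]mul1r ler_pM.
rewrite -[X in _ - X](mul1r u).
apply: le_trans (close_mul close_E1 c1 _ _) _; rewrite ?normr1//.
by have := sq; move: M0 M16; lra.
Qed.

Lemma close_lx : `|u * E1 + P + Q - u| <= 4 * M.
Proof.
have -> : u * E1 + P + Q - u = u * (E1 - 1) + P + Q by ring.
have uE : `|u * (E1 - 1)| <= 2 * M.
  by rewrite normrM -[2 * M]mul1r ler_pM ?close_E1.
rewrite (le_trans (ler_normD _ _))// (le_trans (lerD (ler_normD _ _) QM))//.
by rewrite (le_trans (lerD (lerD uE PM) (lexx M)))//; move: M0 M16; lra.
Qed.

Lemma close_tx : `|u - E1 ^+ 2 * (u * E1 + P + Q) / E2| <= 30 * M.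
Proof.
rewrite distrC.
have c : `|E1 ^+ 2 * (u * E1 + P + Q) - u| <= 11 * M.
  rewrite -[X in _ - X](mul1r u).
  apply: le_trans (close_mul close_sqrE1 close_lx _ _) _; rewrite ?normr1//.
  by have := sq; move: M0 M16; lra.
apply: le_trans (close_div c close_E2 _ _) _ => //; move: M0 M16; lra.
Qed.

Variables (u' P' Q' H dl : R).
Hypotheses (u1' : `|u'| <= 1) (PM' : `|P'| <= M) (HM : `|H| <= M).
Hypothesis close_lx' : `|u' * E1 + P' + Q' - u'| <= 4 * M.
Hypothesis dl01 : `|dl| <= 1.

(** The term - u u' from the Hessian of |x| is cancelled by the leading part of the product that
    implicit differentiation adds. So the Hessian of K is close to the identity over t, although
    that of |x| degenerates radially. *)
Lemma close_xx : `|E1 * ((dl - u * u') * (1 + A) + u' * P + u * P' + H +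
  (u * E1 + P + Q) * (u' * E1 + P' + Q') / E2) - dl| <= 40 * M.
Proof.
have uu : `|u * u'| <= 1 by rewrite normrM mulr_ile1.
have c1 : `|(u * E1 + P + Q) * (u' * E1 + P' + Q') - u * u'| <= 9 * M.
  apply: le_trans (close_mul close_lx close_lx' _ _) _ => //.
  by have := sq; move: M0 M16; lra.
have c2 : `|(u * E1 + P + Q) * (u' * E1 + P' + Q') / E2 - u * u'| <= 26 * M.
  by apply: le_trans (close_div c1 close_E2 _ _) _ => //; move: M0 M16; lra.
have c3 : `|(dl - u * u') * A| <= 2 * M.
  rewrite normrM ler_pM// (le_trans (ler_normB _ _))//.
  by rewrite (le_trans (lerD dl01 uu))//; move: M0 M16; lra.
have c4 : `|u' * P| <= M by rewrite normrM -[M]mul1r ler_pM.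
have c5 : `|u * P'| <= M by rewrite normrM -[M]mul1r ler_pM.
set Y := _ / E2 in c2 *; clearbody Y.
have c : `|(dl - u * u') * (1 + A) + u' * P + u * P' + H + Y - dl| <= 31 * M.
  move: HM c2 c3 c4 c5; rewrite !ler_norml.
  move=> /andP[? ?] /andP[? ?] /andP[? ?] /andP[? ?] /andP[? ?].
  by apply/andP; split; move: M0 M16; lra.
rewrite -[X in _ - X](mul1r dl).
apply: le_trans (close_mul close_E1 c _ _) _; rewrite ?normr1//.
by have := sq; move: M0 M16; lra.
Qed.

End Perturbation.

Lemma is_pderiv_eq {R : realType} {U : normedModType R} (D : set U) v f x (a b : R) :
  is_pderiv D v f x a -> a = b -> is_pderiv D v f x b.
Proof. by move=> + <-. Qed.

(** * Explicit derivatives of S = w |x| (1 + s) *)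

Section PhaseDerivatives.
Context {R : realType} {d : nat} (D : set (R * 'rV[R]_d)).
Hypothesis D0 : forall q, D q -> 0 < q.1 /\ q.2 != 0.
Variables S s : R * 'rV[R]_d -> R.
Let w (q : R * 'rV[R]_d) := Num.sqrt (2 * q.1).
Let N (q : R * 'rV[R]_d) := enorm q.2.
Hypothesis SE : forall q, D q -> S q = w q * N q * (1 + s q).

Let w0 q : D q -> w q != 0.
Proof. by move=> /D0[q1 _]; rewrite gt_eqF// sqrtr_gt0 mulr_gt0. Qed.

Let N0 q : D q -> N q != 0.
Proof. by move=> /D0[_ q2]; rewrite gt_eqF// enorm_gt0. Qed.

Let dw q : D q -> is_pderiv D sdir w q (w q)^-1.
Proof.
move=> Dq; apply: is_pderiv_sqrt2 => [p /D0[/ltW]//|].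
by have [] := D0 Dq.
Qed.

Let dwx i q : is_pderiv D (xdir i) w q 0.
Proof. exact: (@is_pderiv_fun_fst R d D (fun a : R => Num.sqrt (2 * a)) i q). Qed.

Let dN q : is_pderiv D sdir N q 0.
Proof. exact: is_pderiv_snd. Qed.

Let dNx i q : D q -> is_pderiv D (xdir i) N q (q.2 0 i / N q).
Proof. by move=> /D0[_ q2]; exact: is_pderiv_enorm. Qed.

Let is_pderiv1D v q a : is_pderiv D v s q a -> is_pderiv D v (fun q => 1 + s q) q a.
Proof.
by move=> /(is_pderivD (is_pderiv_cst D v q 1)); rewrite add0r.
Qed.

Let SE' : {in D, (fun q => w q * N q * (1 + s q)) =1 S}.
Proof. by move=> q /set_mem /SE ->. Qed.

(** [D] is general because the formula is used both on I x (R^d \ {0}), where the end point of I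
    matters for existence, and on its interior. *)
Definition phase_l q := N q / w q * (1 + s q + w q ^+ 2 * pderiv D sdir s q).

Lemma is_pderiv_phase_l q : D q -> is_pderiv D sdir s q (pderiv D sdir s q) ->
  is_pderiv D sdir S q (phase_l q).
Proof.
move=> Dq sl; apply: (is_pderiv_ext Dq SE').
apply: is_pderiv_eq.
  exact: is_pderivM (is_pderivM (dw Dq) (@dN q)) (is_pderiv1D sl).
by rewrite /phase_l; field; exact: w0.
Qed.

Hypothesis s2 : Ck sxdir D 2 s.

Let sl q := pderiv D sdir s q.
Let sx i q := pderiv D (xdir i) s q.
Let dsl q : D q -> is_pderiv D sdir s q (sl q).
Proof. by move=> Dq; exact: (Ck_pderiv (j := None) s2 Dq). Qed.
Let dsx i q : D q -> is_pderiv D (xdir i) s q (sx i q).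
Proof. by move=> Dq; exact: (Ck_pderiv (j := Some i) s2 Dq). Qed.
Let dsll q : D q -> is_pderiv D sdir sl q (pderiv D sdir sl q).
Proof. by move=> Dq; exact: (Ck_pderiv (j := None) (CkS_pderiv None s2) Dq). Qed.
Let dslx i q : D q -> is_pderiv D sdir (sx i) q (pderiv D sdir (sx i) q).
Proof. by move=> Dq; exact: (Ck_pderiv (j := None) (CkS_pderiv (Some i) s2) Dq). Qed.
Let dsxx i j q : D q -> is_pderiv D (xdir i) (sx j) q (pderiv D (xdir i) (sx j) q).
Proof. by move=> Dq; exact: (Ck_pderiv (j := Some i) (CkS_pderiv (Some j) s2) Dq). Qed.

Definition phase_ll q := - (N q / w q ^+ 3) *
  (1 + s q - 2 * (w q ^+ 2 * sl q) - w q ^+ 4 * pderiv D sdir sl q).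

Lemma is_pderiv_phase_ll q : D q -> is_pderiv D sdir phase_l q (phase_ll q).
Proof.
move=> Dq; have w0q := w0 Dq.
have dw2 : is_pderiv D sdir (fun q => w q ^+ 2) q 2.
  apply: is_pderiv_eq (is_pderivM (dw Dq) (dw Dq)) _.
  by rewrite mulVf// mulfV//.
apply: is_pderiv_eq.
  apply: is_pderivM; first exact: is_pderivM (@dN q) (is_pderivV w0q (dw Dq)).
  exact: is_pderivD (is_pderiv1D (dsl Dq)) (is_pderivM dw2 (dsll Dq)).
by rewrite /phase_ll -/(sl q); field.
Qed.

Definition phase_x i q := w q * (q.2 0 i / N q * (1 + s q) + N q * sx i q).

Lemma is_pderiv_phase_x i q : D q -> is_pderiv D (xdir i) S q (phase_x i q).
Proof.
move=> Dq; apply: (is_pderiv_ext Dq SE').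
apply: is_pderiv_eq.
  exact: is_pderivM (is_pderivM (@dwx i q) (dNx (i := i) Dq))
    (is_pderiv1D (dsx (i := i) Dq)).
by rewrite /phase_x; ring.
Qed.

Definition phase_lx i q := (w q)^-1 *
  (q.2 0 i / N q * (1 + s q + w q ^+ 2 * sl q) + N q * sx i q +
   w q ^+ 2 * N q * pderiv D sdir (sx i) q).

Let dx i v q : is_pderiv D v (fun q => q.2 0 i) q (v.2 0 i).
Proof. exact: is_pderiv_coord. Qed.

Lemma is_pderiv_phase_lx i q : D q -> is_pderiv D sdir (phase_x i) q (phase_lx i q).
Proof.
move=> Dq; have w0q := w0 Dq; have N0q := N0 Dq.
apply: is_pderiv_eq.
  apply: is_pderivM; first exact: dw.
  apply: is_pderivD; last exact: is_pderivM (@dN q) (dslx (i := i) Dq).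
  apply: is_pderivM; last exact: is_pderiv1D (dsl Dq).
  exact: is_pderivM (@dx i sdir q) (is_pderivV N0q (@dN q)).
rewrite /phase_lx [sdir.2 0 i]mxE; field.
by rewrite w0q N0q.
Qed.

(** With u = x / |x|, the entries (delta_ij - u_i u_j) / |x| form the Hessian of |x|; each
    derivative of s carries the power of |x| matching its order. *)
Definition phase_xx i j q := w q / N q *
  (((i == j)%:R - q.2 0 i / N q * (q.2 0 j / N q)) * (1 + s q)
   + q.2 0 j / N q * (N q * sx i q) + q.2 0 i / N q * (N q * sx j q)
   + N q ^+ 2 * pderiv D (xdir i) (sx j) q).

Lemma is_pderiv_phase_xx i j q : D q ->
  is_pderiv D (xdir i) (phase_x j) q (phase_xx i j q).
Proof.
move=> Dq; have w0q := w0 Dq; have N0q := N0 Dq.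
apply: is_pderiv_eq.
  apply: is_pderivM; first exact: (@dwx i q).
  apply: is_pderivD; last exact: is_pderivM (dNx (i := i) Dq) (dsxx (i := i) (j := j) Dq).
  apply: is_pderivM; last exact: is_pderiv1D (dsx (i := i) Dq).
  exact: is_pderivM (@dx j (xdir i) q) (is_pderivV N0q (dNx (i := i) Dq)).
rewrite /phase_xx [(xdir i).2 0 j]mxE eqxx /= (eq_sym j i).
by field.
Qed.

End PhaseDerivatives.

(** * The Legendre transform *)

Section CriticalPoint.
Context {R : realType} {d n : nat} (mu mu' : R).
Hypotheses (mu'0 : 0 < mu') (mu'mu : mu' < mu).
Let I : set R := energies mu'.
Let X : set 'rV[R]_d := [set x | x != 0].
Let D : set (R * 'rV[R]_d) := I `*` X.
Let D' : set (R * 'rV[R]_d) := I `*` setT.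
Let O : set (R * 'rV[R]_d) := half_cylinder (mu' ^+ 2 / 2) X.
Let W : set (R * 'rV[R]_d) := outgoing mu.

Let mu0 : 0 < mu. Proof. exact: lt_trans mu'mu. Qed.

Lemma energiesE a : I a = (mu' ^+ 2 / 2 <= a) :> Prop.
Proof. by rewrite /I /energies /= in_itv /= andbT. Qed.

Lemma threshold_gt0 : 0 < mu' ^+ 2 / 2.
Proof. by rewrite divr_gt0// exprn_gt0. Qed.

Lemma energies_gt0 a : I a -> 0 < a.
Proof. rewrite energiesE; exact: lt_le_trans threshold_gt0. Qed.

Lemma punctured_sub_slab : D `<=` D'. Proof. by move=> p [Ip _]. Qed.

Lemma cylinder_sub : O `<=` D.
Proof. by move=> p [p1 p2]; split=> //; rewrite energiesE ltW. Qed.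

Lemma punctured_gt0 q : D q -> 0 < q.1 /\ q.2 != 0.
Proof. by move=> [/energies_gt0 ? ?]. Qed.

Lemma cylinder_gt0 q : O q -> 0 < q.1 /\ q.2 != 0.
Proof. by move=> /cylinder_sub/punctured_gt0. Qed.

Lemma open_cylinder : open O.
Proof. by apply: open_half_cylinder; exact: open_row_neq0. Qed.

Lemma acc_cylinder : accumulating sxdir O.
Proof. by move=> j p Op; apply: adherent_open => //; exact: open_cylinder. Qed.

Lemma adherent_energies a : I a -> adherent I 1 a.
Proof.
rewrite energiesE => Ia e e0; have e20 : 0 < e / 2 by rewrite divr_gt0.
exists (e / 2); rewrite energiesE [_ *: 1]mulr1 gt_eqF// gtr0_norm//.
by split => //; lra.
Qed.

Lemma accumulating_energies (Y : set 'rV[R]_d) :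
  open Y -> accumulating sxdir (I `*` Y).
Proof.
move=> oY [i|] p [/= Ip Yp] e e0.
  have [h [h0 he Yh]] := @adherent_open _ _ Y (evec i) p.2 oY Yp _ e0.
  by exists h; split => //; split => //=; rewrite [_ *: 0]mulr0 add0r.
have [h [h0 he Ih]] := adherent_energies Ip e0.
by exists h; split => //; split => //=; rewrite scaler0 add0r.
Qed.

Lemma acc_punctured : accumulating sxdir D.
Proof. exact: accumulating_energies open_row_neq0. Qed.

Lemma outgoing_neq0 p : W p -> p.2 != 0.
Proof.
by move=> [p0 pN]; rewrite -enorm_gt0 (lt_le_trans _ pN)// mulr_gt0.
Qed.

(** At a boundary point |x| = mu t there may be room one way only: backwards in time, and in x_i
    away from 0, so that |x| does not decrease. *)
Lemma acc_outgoing : accumulating sxdir W.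
Proof.
move=> j p [p0 pN] e e0; case: j => [i|]; last first.
  pose h := Num.min e p.1 / 2.
  have m0 : 0 < Num.min e p.1 by rewrite lt_min e0 p0.
  have me : Num.min e p.1 <= e by rewrite ge_min lexx.
  have mp : Num.min e p.1 <= p.1 by rewrite ge_min lexx orbT.
  have h0 : 0 < h by rewrite divr_gt0.
  exists (- h); rewrite oppr_eq0 gt_eqF// normrN gtr0_norm//.
  split => //; first by rewrite /h; lra.
  split => /=; rewrite [_ *: 1]mulr1; first by rewrite /h; lra.
  rewrite scaler0 add0r (le_trans _ pN)// ler_wpM2l// ?ltW// /h; lra.
pose h := (if 0 <= p.2 0 i then 1 else -1) * (e / 2).
have hx : 0 <= h * (2 * p.2 0 i + h).
  rewrite /h; move: (p.2 0 i) => y; have [y0|y0] := leP 0 y.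
    by rewrite mul1r mulr_ge0//; lra.
  by rewrite mulN1r mulNr -mulrN mulr_ge0//; lra.
have nh : `|h| = e / 2.
  rewrite /h normrM (gtr0_norm (divr_gt0 e0 _))//.
  by case: ifP => _; rewrite ?normrN normr1 mul1r.
exists h; split; rewrite ?nh.
- by rewrite -normr_gt0 nh divr_gt0.
- by lra.
split => /=; rewrite [_ *: 0]mulr0 add0r//.
rewrite (le_trans pN)// -(ler_pXn2r (n := 2)) ?nnegrE ?enorm_ge0//.
by rewrite sqr_enorm_line lerDl.
Qed.

Variables S s : R * 'rV[R]_d -> R.
Hypothesis Sk : Ck sxdir D n.+2 S.
Hypothesis sk : Ck sxdir D' n.+2 s.
Hypothesis SE : forall a x, I a ->
  S (a, x) = Num.sqrt (2 * a) * enorm x * (1 + s (a, x)).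
Variable M : R * 'rV[R]_d -> R.
Hypotheses (M0 : forall p, 0 <= M p) (M16 : forall p, M p <= 1 / 16).
Hypothesis Mmu : forall p, 2 * M p < 1 - mu' / mu.
(** The weights are those with which derivatives of s enter the derivatives of S, so a single number
    [M p] bounds all the dimensionless quantities. *)
Hypothesis sM : forall k (alpha : 'I_d -> nat) p,
  (k + multi_order alpha <= 2)%N -> D p ->
  `|Num.sqrt (2 * p.1) ^+ (2 * k) * enorm p.2 ^+ multi_order alpha *
    mixed_pderiv D' k alpha s p| <= M p.

Let w (p : R * 'rV[R]_d) := Num.sqrt (2 * p.1).
Let N (p : R * 'rV[R]_d) := enorm p.2.

Let w0 p : D p -> 0 < w p.
Proof. by move=> /punctured_gt0[p1 _]; rewrite sqrtr_gt0 mulr_gt0. Qed.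

Let N0 p : D p -> 0 < N p.
Proof. by move=> /punctured_gt0[_ p2]; rewrite enorm_gt0. Qed.

Lemma Ck_s_punctured : Ck sxdir D 2 s.
Proof. by apply: Ck_le (Ck_sub acc_punctured punctured_sub_slab sk). Qed.

Lemma Ck_s_cylinder : Ck sxdir O 2 s.
Proof. exact: Ck_sub acc_cylinder cylinder_sub Ck_s_punctured. Qed.

Lemma S_punctured p : D p -> S p = w p * N p * (1 + s p).
Proof. by case: p => a x [Ia _]; exact: SE. Qed.

Lemma S_cylinder p : O p -> S p = w p * N p * (1 + s p).
Proof. by move=> /cylinder_sub; exact: S_punctured. Qed.

Lemma s_bound p : D p -> `|s p| <= M p.
Proof.
move=> Dp; have := @sM 0%N (fun=> 0%N) p _ Dp.
rewrite /multi_order big1// => /(_ isT).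
by rewrite mixed_pderivE index_list0 /= !expr0 !mul1r.
Qed.

Lemma sl_bound p : D p -> `|w p ^+ 2 * pderiv D sdir s p| <= M p.
Proof.
move=> Dp; have := @sM 1%N (fun=> 0%N) p _ Dp.
rewrite {1 2}/multi_order big1// => /(_ isT).
rewrite mixed_pderivE index_list0 /= muln1 expr0 mulr1.
by rewrite -(pderiv_sub None acc_punctured punctured_sub_slab sk Dp).
Qed.

Lemma bound_cylinder k (alpha : 'I_d -> nat) p : (k + multi_order alpha <= 2)%N -> O p ->
  `|w p ^+ (2 * k) * N p ^+ multi_order alpha * iterated_pderiv sxdir O s
    (nseq k None ++ map Some (index_list alpha)) p| <= M p.
Proof.
move=> ka2 Op; have := sM ka2 (cylinder_sub Op); rewrite mixed_pderivE.
have szka : size (nseq k None ++ map Some (index_list alpha)) = (k + multi_order alpha)%N.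
  by rewrite size_cat size_nseq size_map size_index_list.
rewrite (iterated_pderiv_sub acc_cylinder
  (subset_trans cylinder_sub punctured_sub_slab))//; last exact/mem_set.
by rewrite szka; apply: (Ck_le _ sk); rewrite (leq_trans ka2).
Qed.

Let index0 : multi_order (fun _ : 'I_d => 0%N) = 0%N.
Proof. by rewrite -size_index_list index_list0. Qed.

Let index1 i : multi_order (fun j : 'I_d => nat_of_bool (j == i)) = 1%N.
Proof. by rewrite -size_index_list index_list1. Qed.

Section Bounds.
Variables (p : R * 'rV[R]_d) (Op : O p).

Lemma bound_s_l : `|w p ^+ 2 * pderiv O sdir s p| <= M p.
Proof.
have := @bound_cylinder 1%N (fun=> 0%N) p.
by rewrite index0 index_list0 /= expr0 mulr1; apply.
Qed.

Lemma bound_s_ll : `|w p ^+ 4 * pderiv O sdir (pderiv O sdir s) p| <= M p.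
Proof.
have := @bound_cylinder 2%N (fun=> 0%N) p.
by rewrite index0 index_list0 /= expr0 mulr1; apply.
Qed.

Lemma bound_s_x i : `|N p * pderiv O (xdir i) s p| <= M p.
Proof.
have := @bound_cylinder 0%N (fun j => nat_of_bool (j == i)) p.
by rewrite index1 index_list1 /= expr0 mul1r expr1; apply.
Qed.

Lemma bound_s_lx i : `|w p ^+ 2 * N p * pderiv O sdir (pderiv O (xdir i) s) p| <= M p.
Proof.
have := @bound_cylinder 1%N (fun j => nat_of_bool (j == i)) p.
by rewrite index1 index_list1 /= expr1; apply.
Qed.

(** Stated for the order of differentiation that a multi-index prescribes, the only one that [sM]
    controls; the final estimate asks for no other. *)
Lemma bound_s_xx alpha i j : index_list alpha = [:: i; j] ->
  `|N p ^+ 2 * pderiv O (xdir i) (pderiv O (xdir j) s) p| <= M p.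
Proof.
move=> aij; have := @bound_cylinder 0%N alpha p.
by rewrite -size_index_list aij /= expr0 mul1r; apply.
Qed.

Let bs := s_bound (cylinder_sub Op).

Lemma pderiv_phase_l : pderiv O sdir S p = phase_l O s p.
Proof.
apply: pderiv_val; first exact: (acc_cylinder None Op).
apply: (is_pderiv_phase_l cylinder_gt0 S_cylinder Op).
exact: (Ck_pderiv (j := None) Ck_s_cylinder Op).
Qed.

Lemma is_pderiv_pderiv_phase_l : is_pderiv O sdir (pderiv O sdir S) p (phase_ll O s p).
Proof.
apply: (is_pderiv_ext (f := phase_l O s) Op); last
  exact: (is_pderiv_phase_ll cylinder_gt0 Ck_s_cylinder Op).
move=> q /set_mem Oq; apply/esym/pderiv_val; first exact: (acc_cylinder None Oq).
apply: (is_pderiv_phase_l cylinder_gt0 S_cylinder Oq).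
exact: (Ck_pderiv (j := None) Ck_s_cylinder Oq).
Qed.

Lemma pderiv_phase_ll : pderiv O sdir (pderiv O sdir S) p = phase_ll O s p.
Proof. exact: pderiv_val (acc_cylinder None Op) is_pderiv_pderiv_phase_l. Qed.

Lemma phase_ll_lt0 : pderiv O sdir (pderiv O sdir S) p < 0.
Proof.
rewrite pderiv_phase_ll /phase_ll mulNr oppr_lt0 mulr_gt0//.
  by rewrite divr_gt0 ?exprn_gt0 ?w0 ?N0//; exact: cylinder_sub.
apply: lt_le_trans (E2_ge (M0 p) (M16 p) bs bound_s_l bound_s_ll).
by [].
Qed.

Lemma is_pderiv_phase_xO i q : O q ->
  is_pderiv O (xdir i) S q (phase_x O s i q).
Proof.
move=> Oq; exact (is_pderiv_phase_x cylinder_gt0 S_cylinder Ck_s_cylinder Oq).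
Qed.

Lemma pderiv_phase_x i : pderiv O (xdir i) S p = phase_x O s i p.
Proof. exact: pderiv_val (acc_cylinder (Some i) Op) (is_pderiv_phase_xO Op). Qed.

Let ext_x i : {in O, phase_x O s i =1 pderiv O (xdir i) S}.
Proof.
move=> q /set_mem Oq; apply/esym/pderiv_val; first exact: (acc_cylinder (Some i) Oq).
exact: is_pderiv_phase_xO.
Qed.

Lemma pderiv_phase_lx i :
  pderiv O sdir (pderiv O (xdir i) S) p = phase_lx O s i p.
Proof.
apply: pderiv_val; first exact: (acc_cylinder None Op).
apply: (is_pderiv_ext Op (@ext_x i)).
exact (is_pderiv_phase_lx cylinder_gt0 Ck_s_cylinder Op).
Qed.

Lemma pderiv_phase_xx i j :
  pderiv O (xdir i) (pderiv O (xdir j) S) p = phase_xx O s i j p.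
Proof.
apply: pderiv_val; first exact: (acc_cylinder (Some i) Op).
apply: (is_pderiv_ext Op (@ext_x j)).
exact (is_pderiv_phase_xx cylinder_gt0 Ck_s_cylinder Op).
Qed.

End Bounds.

Lemma Ck_S_cylinder : Ck sxdir O n.+2 S.
Proof. exact: Ck_sub acc_cylinder cylinder_sub Sk. Qed.

(** The bounds concern derivatives with d_lambda taken last, whereas implicit differentiation of
    d_lambda S = t produces d_i d_lambda S; Schwarz's theorem exchanges them. *)
Lemma pderiv_phase_xl i p : O p ->
  pderiv O (xdir i) (pderiv O sdir S) p = phase_lx O s i p.
Proof.
move=> Op; rewrite -(pderiv_phase_lx Op).
apply: (@pderivC _ _ O sdir (xdir i) S (pderiv O sdir S) (pderiv O (xdir i) S)
  (pderiv O (xdir i) (pderiv O sdir S)) (pderiv O sdir (pderiv O (xdir i) S)) p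
  open_cylinder Op).
- move=> q Oq; exact (Ck_pderiv (j := None) Ck_S_cylinder Oq).
- move=> q Oq; exact (Ck_pderiv (j := Some i) Ck_S_cylinder Oq).
- move=> q Oq; exact (Ck_pderiv (j := Some i) (CkS_pderiv None Ck_S_cylinder) Oq).
- move=> q Oq; exact (Ck_pderiv (j := None) (CkS_pderiv (Some i) Ck_S_cylinder) Oq).
- exact: (Ck_continuous (CkS_pderiv (Some i) (CkS_pderiv None Ck_S_cylinder))).
- exact: (Ck_continuous (CkS_pderiv None (CkS_pderiv (Some i) Ck_S_cylinder))).
Qed.

Lemma pderiv_phase_D p : D p -> pderiv D sdir S p = phase_l D s p.
Proof.
move=> Dp; apply: pderiv_val; first exact: (acc_punctured None Dp).
apply: (is_pderiv_phase_l punctured_gt0 S_punctured Dp).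
exact: (Ck_pderiv (j := None) Ck_s_punctured Dp).
Qed.

(** Along the line through (a, x), difference quotients relative to I and to [D] use the same
    increments, one-sided at the end point in both cases. *)
Lemma critical_pointE t x a : x != 0 ->
  critical_point I (fun a => S (a, x) - a * t) a <->
  I a /\ pderiv D sdir S (a, x) = t.
Proof.
move=> x0.
have key : I a -> is_pderiv I 1 (fun a => S (a, x) - a * t) a
    (pderiv D sdir S (a, x) - t).
  move=> Ia; have Dax : D (a, x) by [].
  have lineE (h : R) : h *: sdir + (a, x) = (h *: 1 + a, x) :> R * 'rV[R]_d.
    by congr pair; rewrite /= scaler0 add0r.
  apply: (@is_pderiv_near _ _ _ _ _ _ _ (fun h => diff_quot sdir S (a, x) h - t)).
    move=> h h0 _; rewrite mulrBr mul_diff_quot// lineE [h *: 1]mulr1; ring.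
  apply: cvgB; last exact: cvg_cst.
  apply: cvg_trans (Ck_pderiv (j := None) Sk Dax); apply: cvg_app.
  have sub A : dirnbhs D sdir (a, x) A -> dirnbhs I 1 a A.
    rewrite /dirnbhs /within /=; apply: filterS => h hA Ih; apply: hA.
    by rewrite lineE.
  exact: sub.
split=> [[Ia _ cr]|[Ia cr]].
  split=> //; apply/eqP; rewrite -subr_eq0 -cr.
  by rewrite (pderiv_val (adherent_energies Ia) (key Ia)).
have k := key Ia; split=> //; first exact: is_pderiv_pderivable k.
by rewrite (pderiv_val (adherent_energies Ia) k) cr subrr.
Qed.

Let E1 p := 1 + s p + w p ^+ 2 * pderiv D sdir s p.

Let E1_close p : D p -> `|E1 p - 1| <= 2 * M p.
Proof. by move=> Dp; exact: close_E1 (s_bound Dp) (sl_bound Dp). Qed.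

Lemma slope_threshold t x : W (t, x) -> t < pderiv D sdir S (mu' ^+ 2 / 2, x).
Proof.
move=> Wtx; have x0 := outgoing_neq0 Wtx; have [/= t0 tN] := Wtx.
have Dp : D (mu' ^+ 2 / 2, x) by split => //=; rewrite energiesE.
rewrite pderiv_phase_D// /phase_l -/(E1 _) /=.
have -> : Num.sqrt (2 * (mu' ^+ 2 / 2)) = mu'.
  by rewrite mulrC divfK// sqrtr_sqr gtr0_norm.
have e1 : mu' / mu < E1 (mu' ^+ 2 / 2, x).
  have := E1_close Dp; have := Mmu (mu' ^+ 2 / 2, x).
  rewrite ler_norml => m /andP[? _]; lra.
have Nx : 0 < enorm x by rewrite enorm_gt0.
apply: (@le_lt_trans _ _ (enorm x / mu' * (mu' / mu))); last first.
  by rewrite ltr_pM2l// divr_gt0.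
by rewrite mulrA divfK ?gt_eqF// ler_pdivlMr// mulrC.
Qed.

Lemma critical_point_interior t x a : W (t, x) -> I a ->
  pderiv D sdir S (a, x) = t -> O (a, x).
Proof.
move=> Wtx Ia cr; split; last exact: outgoing_neq0 Wtx.
rewrite /= lt_neqAle; apply/andP; split; last by move: Ia; rewrite energiesE.
by apply/eqP => aE; have := slope_threshold Wtx; rewrite aE cr ltxx.
Qed.

Lemma critical_point_exists t x : W (t, x) ->
  exists2 a, I a & pderiv D sdir S (a, x) = t.
Proof.
move=> Wtx; have x0 : x != 0 := outgoing_neq0 Wtx; have [/= t0 tN] := Wtx.
have Nx : 0 < enorm x by rewrite enorm_gt0.
pose c := 2 * enorm x / t; pose b := c ^+ 2 / 2.
(* [c] is the value of w where the free slope |x| / w equals t / 2; since 1 + e <= 2, the slope at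
   [b] is at most t. That [b] lies in I follows from |x| >= mu t. *)
have c0 : 0 < c by rewrite divr_gt0// mulr_gt0.
have mu'c : mu' <= c.
  rewrite (le_trans (ltW mu'mu))// ler_pdivlMr// (le_trans tN)//.
  by rewrite ler_peMl ?ltW//; lra.
have ab : mu' ^+ 2 / 2 <= b.
  by rewrite /b ler_pM2r// ler_pXn2r// nnegrE ltW.
have Db : D (b, x) by split => //=; rewrite energiesE.
have fb : pderiv D sdir S (b, x) <= t.
  rewrite pderiv_phase_D// /phase_l -/(E1 _) /=.
  have -> : Num.sqrt (2 * b) = c by rewrite mulrC divfK// sqrtr_sqr gtr0_norm.
  have -> : enorm x / c = t / 2 by rewrite /c; field; rewrite !gt_eqF.
  have e2 : E1 (b, x) <= 2.
    have := E1_close Db; have := M16 (b, x).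
    rewrite ler_norml => m /andP[_ ?]; lra.
  have t2 : 0 <= t / 2 by rewrite divr_ge0// ltW.
  by rewrite (le_trans (ler_wpM2l t2 e2))// divfK.
have fa := slope_threshold Wtx.
have [||a] := @IVT R (fun a => pderiv D sdir S (a, x)) (mu' ^+ 2 / 2) b t ab.
- apply/subspace_continuousP => a; rewrite /= in_itv /= => /andP[aa _].
  have Da : D (a, x) by split => //=; rewrite energiesE.
  have /within_continuousP/(_ _ Da) := Ck_continuous (CkS_pderiv None Sk).
  apply: cvg_comp.
  have cc : (fun a : R => (a, x)) @ within `[mu' ^+ 2 / 2, b] (nbhs a) --> (a, x).
    by apply: cvg_to_pair; [exact: cvg_within|exact: cvg_cst].
  move=> A; rewrite /within /= => DA; have := cc _ DA; rewrite /nbhs /= /within /=.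
  apply: filterS => a' h; rewrite in_itv /= => /andP[aa' bb']; apply: h.
    by rewrite in_itv /= aa' bb'.
  by split => //=; rewrite energiesE.
- by rewrite ge_min le_max fb (ltW fa) orbT.
by rewrite in_itv /= => /andP[aa _] aE; exists a => //; rewrite energiesE.
Qed.

Lemma critical_point_uniq t x a b : W (t, x) -> I a -> I b ->
  pderiv D sdir S (a, x) = t -> pderiv D sdir S (b, x) = t -> a = b.
Proof.
move=> Wtx; wlog ab : a b / a < b => [hw Ia Ib ta tb|Ia Ib ta tb].
  by have [ab|ba|//] := ltgtP a b; [exact: hw|apply/esym; exact: hw].
have Oa := critical_point_interior Wtx Ia ta.
have Ob := critical_point_interior Wtx Ib tb.
have [c /andP[ac cb] E] := vertical_MVT_lt open_row_neq0 Oa ab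
  (fun q Oq => Ck_pderiv (j := None) (CkS_pderiv None Ck_S_cylinder) Oq).
have Oc : O (c, x) by split => /=; [exact: lt_trans Oa.1 ac|exact: Oa.2].
move: E; rewrite !(pderiv_sub None acc_cylinder cylinder_sub Sk)// ta tb subrr
  => /esym/eqP.
rewrite mulf_eq0 subr_eq0 (gt_eqF ab) orbF => /eqP c0.
by have := phase_ll_lt0 Oc; rewrite c0 ltxx.
Qed.

(** * Regularity of K, the Hamilton-Jacobi equation, second derivatives *)

Section Transform.
Variable lam : R * 'rV[R]_d -> R.
Hypothesis lamP : forall p, W p -> I (lam p) /\ pderiv D sdir S (lam p, p.2) = p.1.
Let phi (p : R * 'rV[R]_d) := (lam p, p.2).
Let T := pderiv O sdir S.

Lemma crit_cylinder p : W p -> O (phi p).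
Proof.
case: p => t x Wtx; have [Il cr] := lamP Wtx.
exact: critical_point_interior Wtx Il cr.
Qed.

Lemma slope_at_critical p : W p -> T (phi p) = p.1.
Proof.
move=> Wp; have [_ <-] := lamP Wp.
exact: (pderiv_sub None acc_cylinder cylinder_sub Sk (crit_cylinder Wp)).
Qed.

Let Tk : Ck sxdir O n.+1 T. Proof. exact: CkS_pderiv None Ck_S_cylinder. Qed.

Lemma Ck_lam : Ck sxdir W n.+1 lam.
Proof.
apply: (Ck_implicit open_row_neq0 crit_cylinder acc_outgoing acc_cylinder Tk)
  => // q; last exact: slope_at_critical.
exact: phase_ll_lt0.
Qed.

Definition legendre p := S (phi p) - lam p * p.1.

Definition legendre_pderiv j p :=
  if j is Some i then pderiv O (xdir i) S (phi p) else - lam p.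

(** Envelope principle: the derivative of [lam] occurs with the factor d_lambda S - t, which
    vanishes at the critical point. *)
Lemma is_pderiv_legendre j p : W p ->
  is_pderiv W (sxdir j) legendre p (legendre_pderiv j p).
Proof.
move=> Wp; apply: is_pderiv_eq.
  apply: is_pderivB.
    exact (Ck_fiber_pderiv (j := j) open_row_neq0 crit_cylinder
      (CkW Ck_S_cylinder) Ck_lam Wp).
  apply: is_pderivM; first exact (Ck_pderiv (j := j) Ck_lam Wp).
  exact: is_pderiv_fst.
rewrite -/(phi p) -/T (slope_at_critical Wp).
by case: j => [i|] /=; ring.
Qed.

(** The defining formula alone gives one order less, that of [lam]. The missing order is gained
    through [legendre_pderiv]: the first derivatives involve [lam] itself but none of its
    derivatives. *)
Lemma Ck_legendre : Ck sxdir W n.+2 legendre.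
Proof.
have Sphi : Ck sxdir W n.+1 (fun q => S (phi q)).
  exact: (Ck_fiber open_row_neq0 crit_cylinder acc_outgoing acc_cylinder
    (CkW Ck_S_cylinder) Ck_lam).
apply: (CkS_intro (f' := legendre_pderiv)); first exact: acc_outgoing.
- have cf : Ck sxdir W 0 (fst : R * 'rV[R]_d -> R).
    by split=> //; apply/within_continuousP => q _; exact: cvg_within_fst.
  have C0 : Ck sxdir W 0 legendre.
    apply: CkD; [exact: acc_outgoing|exact: (Ck_le _ Sphi)|].
    apply: CkN; [exact: acc_outgoing|].
    by apply: CkM => //; [exact: acc_outgoing|exact: (Ck_le _ Ck_lam)].
  exact: Ck_continuous C0.
- exact: is_pderiv_legendre.
- case=> [i|]; last exact: (CkN acc_outgoing Ck_lam).
  exact: (Ck_fiber open_row_neq0 crit_cylinder acc_outgoing acc_cylinder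
    (CkS_pderiv (Some i) Ck_S_cylinder) Ck_lam).
Qed.

Lemma hamilton_jacobi (V : 'rV[R]_d -> R) p : W p ->
  (forall q, D q -> 2^-1 * sq_gradx D S q + V q.2 = q.1) ->
  pderiv W sdir legendre p + 2^-1 * sq_gradx W legendre p + V p.2 = 0.
Proof.
move=> Wp eik; have := eik _ (cylinder_sub (crit_cylinder Wp)).
rewrite (pderiv_val (acc_outgoing None Wp) (is_pderiv_legendre (j := None) Wp)) /=.
have -> : sq_gradx D S (phi p) = sq_gradx W legendre p; last by move=> <-; ring.
apply: eq_bigr => i _.
rewrite (pderiv_val (acc_outgoing (Some i) Wp)
  (is_pderiv_legendre (j := Some i) Wp)) /=.
by rewrite (pderiv_sub (Some i) acc_cylinder cylinder_sub Sk (crit_cylinder Wp)).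
Qed.

Lemma is_pderiv_lam_t p : W p ->
  is_pderiv W sdir lam p (phase_ll O s (phi p))^-1.
Proof.
move=> Wp; apply: is_pderiv_eq.
  exact (Ck_implicit_pderiv (j := None) open_row_neq0 crit_cylinder Tk
    (fun q => @phase_ll_lt0 q) slope_at_critical Wp).
rewrite /= subr0 mul1r; congr (_^-1); exact (pderiv_phase_ll (crit_cylinder Wp)).
Qed.

Lemma is_pderiv_lam_x i p : W p ->
  is_pderiv W (xdir i) lam p (- phase_lx O s i (phi p) / phase_ll O s (phi p)).
Proof.
move=> Wp; apply: is_pderiv_eq.
  exact (Ck_implicit_pderiv (j := Some i) open_row_neq0 crit_cylinder Tk
    (fun q => @phase_ll_lt0 q) slope_at_critical Wp).
rewrite /= sub0r; congr (- _ / _); first exact (pderiv_phase_xl i (crit_cylinder Wp)).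
exact (pderiv_phase_ll (crit_cylinder Wp)).
Qed.

Lemma is_pderiv_legendre_tt p : W p ->
  is_pderiv W sdir (legendre_pderiv None) p (- (phase_ll O s (phi p))^-1).
Proof. by move=> Wp; exact/is_pderivN/is_pderiv_lam_t. Qed.

Lemma is_pderiv_legendre_tx i p : W p ->
  is_pderiv W sdir (legendre_pderiv (Some i)) p
    (phase_lx O s i (phi p) / phase_ll O s (phi p)).
Proof.
move=> Wp; apply: is_pderiv_eq.
  exact (Ck_fiber_pderiv (j := None) open_row_neq0 crit_cylinder
    (CkS_pderiv (Some i) Ck_S_cylinder) Ck_lam Wp).
rewrite addr0; congr (_ * _); first exact (pderiv_phase_lx (crit_cylinder Wp) i).
exact (pderiv_val (acc_outgoing None Wp) (is_pderiv_lam_t Wp)).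
Qed.

Lemma is_pderiv_legendre_xx i j p : W p ->
  is_pderiv W (xdir i) (legendre_pderiv (Some j)) p
    (phase_xx O s i j (phi p) -
      phase_lx O s i (phi p) * phase_lx O s j (phi p) / phase_ll O s (phi p)).
Proof.
move=> Wp; apply: is_pderiv_eq.
  exact (Ck_fiber_pderiv (j := Some i) open_row_neq0 crit_cylinder
    (CkS_pderiv (Some j) Ck_S_cylinder) Ck_lam Wp).
transitivity (phase_lx O s j (phi p) *
  (- phase_lx O s i (phi p) / phase_ll O s (phi p)) + phase_xx O s i j (phi p)).
  congr (_ * _ + _).
  - exact (pderiv_phase_lx (crit_cylinder Wp) j).
  - exact (pderiv_val (acc_outgoing (Some i) Wp) (is_pderiv_lam_x (i := i) Wp)).
  - exact (pderiv_phase_xx (crit_cylinder Wp) i j).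
have alg (a b c e : R) : a * (- b / c) + e = e - b * a / c by ring.
exact: alg.
Qed.

Definition free_phase (p : R * 'rV[R]_d) := enorm p.2 ^+ 2 / (2 * p.1).

Definition free_pderiv j (p : R * 'rV[R]_d) :=
  if j is Some i then p.2 0 i / p.1 else - (enorm p.2 ^+ 2 / (2 * p.1 ^+ 2)).

Let t0 p : W p -> p.1 != 0. Proof. by move=> [p0 _]; rewrite gt_eqF. Qed.

Let dt p : is_pderiv W sdir (fst : R * 'rV[R]_d -> R) p 1.
Proof. exact: (@is_pderiv_fst R d W None p). Qed.

Let dtx i p : is_pderiv W (xdir i) (fst : R * 'rV[R]_d -> R) p 0.
Proof. exact: (@is_pderiv_fst R d W (Some i) p). Qed.

Let dN p : is_pderiv W sdir (fun q : R * 'rV[R]_d => enorm q.2 ^+ 2) p 0.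
Proof. exact: (@is_pderiv_snd _ _ W (fun x => enorm x ^+ 2)). Qed.

Lemma is_pderiv_free j p : W p ->
  is_pderiv W (sxdir j) free_phase p (free_pderiv j p).
Proof.
move=> Wp; have p0 := t0 Wp.
have p20 : 2 * p.1 != 0 by rewrite mulf_neq0.
case: j => [i|] /=; apply: is_pderiv_eq.
- apply: is_pderivM; first exact: is_pderiv_sqr_enorm.
  by apply: is_pderivV => //; exact: is_pderivZ (@dtx i p).
- by rewrite /=; field.
- apply: is_pderivM; first exact: dN.
  by apply: is_pderivV => //; exact: is_pderivZ (@dt p).
- by rewrite /=; field.
Qed.

Lemma is_pderiv_free_tt p : W p ->
  is_pderiv W sdir (free_pderiv None) p (enorm p.2 ^+ 2 / p.1 ^+ 3).
Proof.
move=> Wp; have p0 := t0 Wp.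
have p20 : 2 * (p.1 * p.1) != 0 by rewrite !mulf_neq0.
apply: is_pderiv_eq.
  apply: is_pderivN; apply: is_pderivM; first exact: dN.
  by apply: is_pderivV => //; exact: is_pderivZ (is_pderivM (@dt p) (@dt p)).
by rewrite /=; field.
Qed.

Lemma is_pderiv_free_tx i p : W p ->
  is_pderiv W sdir (free_pderiv (Some i)) p (- (p.2 0 i / p.1 ^+ 2)).
Proof.
move=> Wp; have p0 := t0 Wp; apply: is_pderiv_eq.
  apply: is_pderivM; first exact: is_pderiv_coord.
  by apply: is_pderivV => //; exact: dt.
by rewrite [sdir.2 0 i]mxE; field.
Qed.

Lemma is_pderiv_free_xx i j p : W p ->
  is_pderiv W (xdir i) (free_pderiv (Some j)) p ((i == j)%:R / p.1).
Proof.
move=> Wp; have p0 := t0 Wp; apply: is_pderiv_eq.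
  apply: is_pderivM; first exact: is_pderiv_coord.
  by apply: is_pderivV => //; exact: dtx.
by rewrite [(xdir i).2 0 j]mxE eqxx /= (eq_sym j i); field.
Qed.

Let F p := legendre p - free_phase p.

Lemma pderiv_diff j : {in W, pderiv W (sxdir j) F =1
  (fun p => legendre_pderiv j p - free_pderiv j p)}.
Proof.
move=> p /set_mem Wp; apply: pderiv_val; first exact: (acc_outgoing j Wp).
by apply: is_pderivB; [exact: is_pderiv_legendre|exact: is_pderiv_free].
Qed.

(** The first-order formula holds on all of [W], so it may be differentiated again relative to
    [W]. *)
Lemma pderiv2_diff j j' p a b : W p ->
  is_pderiv W (sxdir j) (legendre_pderiv j') p a ->
  is_pderiv W (sxdir j) (free_pderiv j') p b ->
  pderiv W (sxdir j) (pderiv W (sxdir j') F) p = a - b.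
Proof.
move=> Wp da db; apply: pderiv_val; first exact: (acc_outgoing j Wp).
apply: (@is_pderiv_ext _ _ W (sxdir j)
  (fun p => legendre_pderiv j' p - free_pderiv j' p)) => //.
  by move=> q Wq; rewrite pderiv_diff.
exact: is_pderivB.
Qed.

(** * Comparison with the free phase at one point *)

Section PointwiseBounds.
Variables (p : R * 'rV[R]_d) (Wp : W p).
Let q := phi p.
Let Oq : O q := crit_cylinder Wp.
Let A := s q.
Let B := w q ^+ 2 * pderiv O sdir s q.
Let C := w q ^+ 4 * pderiv O sdir (pderiv O sdir s) q.
Let P i := N q * pderiv O (xdir i) s q.
Let Q i := w q ^+ 2 * N q * pderiv O sdir (pderiv O (xdir i) s) q.
Let u i := p.2 0 i / enorm p.2.
Let G1 := 1 + A + B.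
Let G2 := 1 + A - 2 * B - C.
Let M1 : M q <= 1 / 16 := M16 q.
Let Mq0 : 0 <= M q := M0 q.
Let AM : `|A| <= M q := s_bound (cylinder_sub Oq).
Let BM : `|B| <= M q := bound_s_l Oq.
Let CM : `|C| <= M q := bound_s_ll Oq.
Let PM i : `|P i| <= M q := bound_s_x Oq i.
Let QM i : `|Q i| <= M q := bound_s_lx Oq i.

Let Np0 : 0 < enorm p.2. Proof. by rewrite enorm_gt0; exact: outgoing_neq0. Qed.
Let tp0 : 0 < p.1. Proof. by case: Wp. Qed.

Let u1 i : `|u i| <= 1.
Proof.
by rewrite normrM normfV (gtr0_norm Np0) ler_pdivrMr// mul1r coord_le_enorm.
Qed.

Let G1p : 1 / 2 <= G1. Proof. exact: E1_ge AM BM. Qed.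
Let G2p : 1 / 2 <= G2. Proof. exact: E2_ge AM BM CM. Qed.

Let wq0 : 0 < w q. Proof. exact: w0 (cylinder_sub Oq). Qed.

Let wE : w q = enorm p.2 * G1 / p.1.
Proof.
have TE : enorm p.2 / w q * G1 = p.1.
  by rewrite -(slope_at_critical Wp) /T (pderiv_phase_l Oq).
apply: (mulIf (lt0r_neq0 tp0)); rewrite divfK ?gt_eqF// -{1}TE.
by rewrite mulrA mulrCA divff ?gt_eqF// mulr1.
Qed.

Let lamE : lam p = w q ^+ 2 / 2.
Proof.
have [Il _] := lamP Wp.
rewrite sqr_sqrtr; last by rewrite mulr_ge0// ltW//; exact: energies_gt0.
by rewrite [2 * _]mulrC mulfK.
Qed.

(** From w = |x| G1 / t and G1 >= 1/2 one gets 2 lambda = w^2 >= |x|^2 / (4 t^2), whence the 8. *)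
Lemma sqr_enorm_le_energy : enorm p.2 ^+ 2 <= 8 * p.1 ^+ 2 * lam p.
Proof.
rewrite lamE wE; move: G1p; set g := G1 => g2.
have -> : 8 * p.1 ^+ 2 * ((enorm p.2 * g / p.1) ^+ 2 / 2) =
    enorm p.2 ^+ 2 * (4 * g ^+ 2) by field; rewrite gt_eqF.
by rewrite ler_peMr ?sqr_ge0//; nra.
Qed.

(** Each difference is a monomial [c] in |x| and t times a dimensionless [Y]; 40 is the largest
    constant of the perturbation estimates and serves for all. *)
Let scaled Z c Y kappa : Z = c * Y -> 0 <= c -> `|Y| <= kappa * M q ->
  kappa <= 40 -> `|Z| <= 40 * M q * c.
Proof.
move=> -> c0 Yk k40; rewrite normrM ger0_norm// mulrC ler_wpM2r//.
by rewrite (le_trans Yk)// ler_wpM2r.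
Qed.

Let Gneq0 : (G1 != 0) * (G2 != 0).
Proof. by rewrite !gt_eqF// (lt_le_trans _ G1p, lt_le_trans _ G2p). Qed.

Let neq0 : (enorm p.2 != 0) * (p.1 != 0). Proof. by rewrite !gt_eqF. Qed.

Let phase_llE : phase_ll O s q = - (enorm p.2 / w q ^+ 3) * G2. Proof. by []. Qed.

Let phase_xE i : phase_x O s i q = w q * (u i * (1 + A) + P i). Proof. by []. Qed.

Let phase_lxE i : phase_lx O s i q = (w q)^-1 * (u i * G1 + P i + Q i).
Proof. by []. Qed.

Lemma bound_legendre : `|F p| <= 40 * M q * (enorm p.2 ^+ 2 / p.1).
Proof.
apply: (@scaled _ _ ((2 * A + 2 * (A + B) * A - (A + B) ^+ 2) / 2) 2) => //.
- rewrite /F /legendre /free_phase -/q (S_cylinder Oq) lamE -/A.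
  rewrite (_ : N q = enorm p.2)// wE /G1.
  have alg (a b m t : R) : t != 0 ->
    m * (1 + a + b) / t * m * (1 + a) - (m * (1 + a + b) / t) ^+ 2 / 2 * t -
      m ^+ 2 / (2 * t) = m ^+ 2 / t * ((2 * a + 2 * (a + b) * a - (a + b) ^+ 2) / 2).
    by move=> t0'; field.
  by apply: alg; rewrite neq0.
- by rewrite divr_ge0 ?sqr_ge0// ltW.
- have c := close_phase Mq0 M1 AM BM.
  by rewrite normrM normfV (ger0_norm (_ : 0 <= 2))// ler_pdivrMr//; lra.
- by lra.
Qed.

Lemma bound_legendre_t :
  `|legendre_pderiv None p - free_pderiv None p| <=
    40 * M q * (enorm p.2 ^+ 2 / p.1 ^+ 2).
Proof.
apply: (@scaled _ _ ((1 - G1 ^+ 2) / 2) 5).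
- rewrite /legendre_pderiv /free_pderiv lamE wE.
  have alg (g m t : R) : t != 0 -> - ((m * g / t) ^+ 2 / 2) - - (m ^+ 2 / (2 * t ^+ 2)) =
      m ^+ 2 / t ^+ 2 * ((1 - g ^+ 2) / 2) by move=> t0'; field.
  by apply: alg; rewrite neq0.
- by rewrite divr_ge0 ?sqr_ge0.
- have := close_sqrE1 Mq0 M1 AM BM; rewrite distrC => c.
  rewrite normrM normfV (ger0_norm (_ : 0 <= 2))// ler_pdivrMr//.
  by apply: le_trans c _; have := Mq0; lra.
- by lra.
Qed.

Lemma bound_legendre_x i :
  `|legendre_pderiv (Some i) p - free_pderiv (Some i) p| <=
    40 * M q * (enorm p.2 / p.1).
Proof.
apply: (@scaled _ _ (G1 * (u i * (1 + A) + P i) - u i) 5).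
- rewrite /legendre_pderiv /free_pderiv -/q (pderiv_phase_x Oq) phase_xE wE /u.
  have alg (g m t x y a : R) : t != 0 -> m != 0 ->
      m * g / t * (x / m * (1 + a) + y) - x / t =
      m / t * (g * (x / m * (1 + a) + y) - x / m).
    by move=> t0' n0; field; rewrite t0' n0.
  by apply: alg; rewrite neq0.
- by rewrite divr_ge0 ?enorm_ge0// ltW.
- exact (close_x Mq0 M1 AM BM (@u1 i) (@PM i)).
- by lra.
Qed.

Lemma bound_legendre_tt :
  `|- (phase_ll O s q)^-1 - enorm p.2 ^+ 2 / p.1 ^+ 3| <=
    40 * M q * (enorm p.2 ^+ 2 / p.1 ^+ 3).
Proof.
apply: (@scaled _ _ (G1 ^+ 3 / G2 - 1) 24).
- rewrite phase_llE wE.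
  have alg (g g' m t : R) : t != 0 -> m != 0 -> g != 0 -> g' != 0 ->
      - (- (m / (m * g / t) ^+ 3) * g')^-1 - m ^+ 2 / t ^+ 3 =
      m ^+ 2 / t ^+ 3 * (g ^+ 3 / g' - 1).
    by move=> t0' n0 g0 g0'; field; rewrite t0' n0 g0 g0'.
  by apply: alg; rewrite ?neq0 ?Gneq0.
- by rewrite divr_ge0 ?sqr_ge0// exprn_ge0// ltW.
- exact (close_tt Mq0 M1 AM BM CM).
- by lra.
Qed.

Lemma bound_legendre_tx i :
  `|phase_lx O s i q / phase_ll O s q - - (p.2 0 i / p.1 ^+ 2)| <=
    40 * M q * (enorm p.2 / p.1 ^+ 2).
Proof.
apply: (@scaled _ _ (u i - G1 ^+ 2 * (u i * G1 + P i + Q i) / G2) 30).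
- rewrite phase_llE phase_lxE wE /u.
  have alg (g g' m t x y z : R) : t != 0 -> m != 0 -> g != 0 -> g' != 0 ->
      (m * g / t)^-1 * (x / m * g + y + z) / (- (m / (m * g / t) ^+ 3) * g') -
        - (x / t ^+ 2) =
      m / t ^+ 2 * (x / m - g ^+ 2 * (x / m * g + y + z) / g').
    by move=> t0' n0 g0 g0'; field; rewrite t0' n0 g0 g0'.
  by apply: alg; rewrite ?neq0 ?Gneq0.
- by rewrite divr_ge0 ?enorm_ge0// exprn_ge0// ltW.
- exact (close_tx Mq0 M1 AM BM CM (@u1 i) (@PM i) (@QM i)).
- by lra.
Qed.

Lemma bound_legendre_xx alpha i j : index_list alpha = [:: i; j] ->
  `|phase_xx O s i j q - phase_lx O s i q * phase_lx O s j q / phase_ll O s q -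
     (i == j)%:R / p.1| <= 40 * M q * p.1^-1.
Proof.
move=> aij; have HM := bound_s_xx Oq aij.
pose H := N q ^+ 2 * pderiv O (xdir i) (pderiv O (xdir j) s) q.
have phase_xxE : phase_xx O s i j q = w q / enorm p.2 *
  (((i == j)%:R - u i * u j) * (1 + A) + u j * P i + u i * P j + H) by [].
apply: (@scaled _ _ (G1 * (((i == j)%:R - u i * u j) * (1 + A) + u j * P i +
  u i * P j + H + (u i * G1 + P i + Q i) * (u j * G1 + P j + Q j) / G2)
  - (i == j)%:R) 40) => //.
- rewrite phase_llE !phase_lxE phase_xxE wE.
  have alg (g g' m t Z y z dl : R) : t != 0 -> m != 0 -> g != 0 -> g' != 0 ->
      m * g / t / m * Z - (m * g / t)^-1 * y * ((m * g / t)^-1 * z) /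
        (- (m / (m * g / t) ^+ 3) * g') - dl / t =
      t^-1 * (g * (Z + y * z / g') - dl).
    by move=> t0' n0 g0 g0'; field; rewrite t0' n0 g0 g0'.
  by apply: alg; rewrite ?neq0 ?Gneq0.
- by rewrite invr_ge0 ltW.
- apply: (close_xx Mq0 M1 AM BM CM (@u1 i) (@PM i) (@QM i) (@u1 j) (@PM j) HM).
    exact (close_lx Mq0 M1 AM BM (@u1 j) (@PM j) (@QM j)).
  by case: eqP; rewrite ?normr1 ?normr0.
Qed.

(** Six kinds of derivative occur, with those in t outermost. The power |x|^(2 - |alpha|) is written
    as a quotient to avoid truncated subtraction. *)
Lemma bound_mixed_pderiv k (alpha : 'I_d -> nat) : (k + multi_order alpha <= 2)%N ->
  `|mixed_pderiv W k alpha F p| <=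
    40 * M q * (enorm p.2 ^+ 2 / (enorm p.2 ^+ multi_order alpha * p.1 ^+ k.+1)).
Proof.
rewrite mixed_pderivE -size_index_list.
have [n0 t0'] := neq0.
case E: (index_list alpha) => [|i [|j [|? ?]]]; case: k => [|[|[|k]]] //= _;
  rewrite /iterated_pderiv /=.
- by rewrite expr0 mul1r expr1; exact: bound_legendre.
- rewrite expr0 mul1r [pderiv _ _ _ _](@pderiv_diff None p (mem_set Wp)).
  exact: bound_legendre_t.
- rewrite [pderiv _ _ _ _](pderiv2_diff (j := None) (j' := None) Wp
    (is_pderiv_legendre_tt Wp) (is_pderiv_free_tt Wp)).
  by rewrite expr0 mul1r; exact: bound_legendre_tt.
- rewrite [pderiv _ _ _ _](@pderiv_diff (Some i) p (mem_set Wp)).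
  rewrite (_ : enorm p.2 ^+ 2 / _ = enorm p.2 / p.1); first exact: bound_legendre_x.
  by field; rewrite t0' n0.
- rewrite [pderiv _ _ _ _](pderiv2_diff (j := None) (j' := Some i) Wp
    (is_pderiv_legendre_tx (i := i) Wp) (is_pderiv_free_tx (i := i) Wp)).
  rewrite (_ : enorm p.2 ^+ 2 / _ = enorm p.2 / p.1 ^+ 2); first exact: bound_legendre_tx.
  by field; rewrite t0' n0.
- rewrite [pderiv _ _ _ _](pderiv2_diff (j := Some i) (j' := Some j) Wp
    (is_pderiv_legendre_xx (i := i) (j := j) Wp)
    (is_pderiv_free_xx (i := i) (j := j) Wp)).
  rewrite (_ : enorm p.2 ^+ 2 / _ = p.1^-1); first exact: bound_legendre_xx E.
  by field; rewrite t0' n0.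
Qed.

End PointwiseBounds.
End Transform.
End CriticalPoint.

(** * Smallness of s for a large cut-off radius *)

Section UniformBounds.
Context {R : realType} {d : nat} (mu' sigma C r eps : R).
Variable s : R * 'rV[R]_d -> R.
Hypotheses (mu'0 : 0 < mu') (sigma0 : 0 < sigma) (C0 : 0 < C) (eps0 : 0 <= eps).
Let I : set R := energies mu'.
Let D' : set (R * 'rV[R]_d) := I `*` setT.

Hypothesis s0 : forall a x, I a -> enorm x <= r -> s (a, x) = 0.
Hypothesis sC : forall k (alpha : 'I_d -> nat) a x, (k + multi_order alpha <= 2)%N ->
  I a -> `|mixed_pderiv D' k alpha s (a, x)| <=
    C * a ^- k.+1 * jap x `^ (- sigma - (multi_order alpha)%:R).
Hypotheses (r1 : 1 <= r) (rC : 4 * C * (2 / mu' ^+ 2) <= eps * r `^ sigma).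

(* Bounds the derivatives of [s] after scaling.  It vanishes for [|x| < r],
   as [s] does; elsewhere [<x> <= 2 |x|]. *)
Definition symbol_size (p : R * 'rV[R]_d) : R :=
  if (mu' ^+ 2 / 2 <= p.1) && (r <= enorm p.2)
  then 4 * C / p.1 * jap p.2 `^ (- sigma) else 0.

Let jap_neq0 (x : 'rV[R]_d) : jap x != 0. Proof. by rewrite gt_eqF// jap_gt0. Qed.

Lemma symbol_size_ge0 p : 0 <= symbol_size p.
Proof.
rewrite /symbol_size; case: ifP => // /andP[p1 _].
have p0 : 0 < p.1 := lt_le_trans (threshold_gt0 mu'0) p1.
by rewrite mulr_ge0 ?powR_ge0// divr_ge0 ?mulr_ge0 ?ltW.
Qed.

(** Where the size is not zero, 1 / lambda <= 2 / mu'^2 and <x> >= r; hypothesis [rC] is the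
    inequality that then remains. *)
Lemma symbol_size_le p : symbol_size p <= eps.
Proof.
rewrite /symbol_size; case: ifP => // /andP[p1 rp].
have p0 : 0 < p.1 := lt_le_trans (threshold_gt0 mu'0) p1.
have m0 : 0 < mu' ^+ 2 by rewrite exprn_gt0.
have r0 : 0 < r := lt_le_trans ltr01 r1.
have rs0 : 0 < r `^ sigma by rewrite powR_gt0.
have pV : p.1^-1 <= 2 / mu' ^+ 2.
  by rewrite -[2 / _]invrK invf_div lef_pV2 ?posrE ?divr_gt0.
have jr : r `^ sigma <= jap p.2 `^ sigma.
  apply: (ge0_ler_powR (ltW sigma0)); rewrite ?nnegrE ?(ltW r0) ?(ltW (jap_gt0 _))//.
  exact: le_trans rp (enorm_le_jap _).
rewrite powRN ler_pdivrMr ?powR_gt0 ?jap_gt0//.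
apply: (@le_trans _ _ (4 * C * (2 / mu' ^+ 2))).
  by rewrite ler_pM2l// mulr_gt0.
by rewrite (le_trans rC)// ler_wpM2l.
Qed.

(** The 4 comes from w^(2 k) = (2 lambda)^k and 2^k <= 4; the remaining lambda^k and |x|^|alpha| are
    absorbed by the decay of the derivative. *)
Lemma symbol_size_bound k (alpha : 'I_d -> nat) p : (k + multi_order alpha <= 2)%N ->
  I p.1 ->
  `|Num.sqrt (2 * p.1) ^+ (2 * k) * enorm p.2 ^+ multi_order alpha *
    mixed_pderiv D' k alpha s p| <= symbol_size p.
Proof.
case: p => a x ka2 /= Ia; have a0 : 0 < a := energies_gt0 mu'0 Ia.
have [xr|rx] := ltP (enorm x) r.
  rewrite mixed_pderivE (@iterated_pderiv_eq0 _ _ _ _ D' [set q | enorm q.2 < r]).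
  - by rewrite mulr0 normr0 symbol_size_ge0.
  - exact: accumulating_energies openT.
  - rewrite (_ : [set q | _] =
        (fun q : R * 'rV[R]_d => enorm q.2) @^-1` [set y | y < r])//.
    apply: open_comp => [q _|]; last exact: open_lt.
    apply: cvg_comp (@cvg_nbhs_snd _ _ q) _; exact: enorm_continuous.
  - by move=> [b y] [/= Ib _] /ltW; exact: s0.
  - by split.
  - by [].
have aI : mu' ^+ 2 / 2 <= a by move: Ia; rewrite /I energiesE.
rewrite /symbol_size /= aI rx /= !normrM.
have -> : Num.sqrt (2 * a) ^+ (2 * k) = (2 * a) ^+ k.
  by rewrite exprM sqr_sqrtr// mulr_ge0// ltW.
have a20 : 0 <= 2 * a by rewrite mulr_ge0// ltW.
rewrite (ger0_norm (exprn_ge0 k a20)) (ger0_norm (exprn_ge0 _ (enorm_ge0 x))).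
have jx0 := jap_gt0 x.
set m := multi_order alpha in ka2 *.
have Nm : enorm x ^+ m <= jap x ^+ m.
  by rewrite lerXn2r ?nnegrE ?enorm_ge0 ?enorm_le_jap ?(ltW jx0).
have k4 : (2 : R) ^+ k <= 4.
  have : (k <= 2)%N by rewrite (leq_trans _ ka2)// leq_addr.
  by case: k {ka2} => [|[|[|?]]] // _; rewrite ?expr0 ?expr1 ?expr2; lra.
have Cb : C * a ^- k.+1 * jap x `^ (- sigma - m%:R) =
    C * a^-1 * jap x `^ (- sigma) * (a ^- k * jap x ^- m).
  rewrite powRB ?jap_neq0 ?implybT// powR_mulrn ?ltW//.
  by rewrite exprS invfM; ring.
apply: (@le_trans _ _ ((2 * a) ^+ k * jap x ^+ m *
    (C * a^-1 * jap x `^ (- sigma) * (a ^- k * jap x ^- m)))).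
  rewrite -Cb; apply: ler_pM => //; last exact: sC.
    by rewrite mulr_ge0 ?exprn_ge0 ?enorm_ge0.
  by rewrite ler_wpM2l ?exprn_ge0.
have -> : (2 * a) ^+ k * jap x ^+ m *
    (C * a^-1 * jap x `^ (- sigma) * (a ^- k * jap x ^- m)) =
    2 ^+ k * (C / a * jap x `^ (- sigma)).
  rewrite exprMn.
  have ak0 : a ^+ k != 0 by rewrite expf_neq0// gt_eqF.
  have jm0 : jap x ^+ m != 0 by rewrite expf_neq0// gt_eqF.
  by field; rewrite ak0 jm0 gt_eqF.
rewrite -!mulrA ler_wpM2r// mulr_ge0 ?(ltW C0)//.
by rewrite mulr_ge0 ?powR_ge0// invr_ge0 ltW.
Qed.

End UniformBounds.

(** * Choice of the radius and the constant; the final estimate *)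

Theorem theorem1p14 (R : realType) (d l : nat) (hd : (2 <= d)%N) (hl : (2 <= l)%N)
    (sigma rho : R) (V q : 'rV[R]_d -> R) (hA : condition_A l sigma rho V q)
    (chi : R -> R) (hchi : cutoff chi)
    (mu mu' : R) (hmu' : 0 < mu') (hmu : mu' < mu)
    (hS : eikonal_regularity l sigma rho chi V (energies mu')) :
  exists r1 C : R, [/\ 0 < r1, 0 < C & forall r : R, r1 <= r ->
    (forall t x, outgoing mu (t, x) ->
       exists! lambda, critical_point (energies mu') (phase chi V r t x) lambda) /\
    forall lambda_c : R * 'rV[R]_d -> R,
      (forall t x, outgoing mu (t, x) ->
         critical_point (energies mu') (phase chi V r t x) (lambda_c (t, x))) ->
      let K := fun p : R * 'rV[R]_d => phase chi V r p.1 p.2 (lambda_c p) in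
      let Omega := outgoing mu in
      [/\ Ck sxdir Omega l K,
          forall p, Omega p ->
            pderiv Omega sdir K p + 2^-1 * sq_gradx Omega K p
              + cut_potential chi V r p.2 = 0 &
          forall (k : nat) (alpha : 'I_d -> nat),
            (k + multi_order alpha <= 2)%N ->
            forall t x, Omega (t, x) ->
              `|mixed_pderiv Omega k alpha
                  (fun p => K p - enorm p.2 ^+ 2 / (2 * p.1)) (t, x)| <=
                C * t `^ (1 - k%:R) * jap x `^ (- sigma - (multi_order alpha)%:R)]].
Proof.
case: hA => -[/andP[sigma0 _] _ _ _] _.
case: hS => r0 [C [r0_gt0 C0 hS]].
case: l hl hS => [|[|n]] // _ hS.
have mu0 : 0 < mu := lt_trans hmu' hmu.
have mu1 : mu' / mu < 1 by rewrite ltr_pdivrMr// mul1r.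
(* The first entry serves the perturbation estimates; the second makes 1 + e exceed mu' / mu, which
   keeps the critical point inside I. *)
pose eps := Num.min (1 / 16) ((1 - mu' / mu) / 4).
have eps0 : 0 < eps by rewrite lt_min; apply/andP; split; lra.
have eps16 : eps <= 1 / 16 by rewrite ge_min lexx.
have epsmu : 2 * eps < 1 - mu' / mu.
  have : eps <= (1 - mu' / mu) / 4 by rewrite ge_min lexx orbT.
  lra.
pose B := 4 * C * (2 / mu' ^+ 2) / eps.
have B0 : 0 <= B by rewrite divr_ge0 ?mulr_ge0 ?invr_ge0 ?exprn_ge0 ?ltW.
(* The radius 1 makes <x> <= 2 |x| available, and the last one brings the symbols below [eps]. In
   the constant, 40 is that of the pointwise bounds, 4 comes from <x>^m <= 4 |x|^m with m <= 2, 8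
   from |x|^2 <= 8 t^2 lambda, and 4 C from [symbol_size]. It does not depend on the radius. *)
exists (Num.max r0 (Num.max 1 (B `^ sigma^-1))), (40 * (4 * (8 * (4 * C)))).
split.
- by rewrite lt_max r0_gt0.
- by rewrite !mulr_gt0.
move=> r.
rewrite !ge_max => /andP[r0r /andP[r1 rB]].
case: (hS r r0r) => Sk eik [s [sk s0 SE sC]].
have rC : 4 * C * (2 / mu' ^+ 2) <= eps * r `^ sigma.
  by rewrite -ler_pdivrMl// mulrC; exact: powR_unbounded.
pose M := symbol_size (d := d) mu' sigma C r.
have M0 p : 0 <= M p := symbol_size_ge0 sigma r hmu' C0 p.
have Meps p : M p <= eps := symbol_size_le hmu' sigma0 C0 (ltW eps0) r1 rC p.
have M16 p : M p <= 1 / 16 by exact: le_trans (Meps p) eps16.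
have Mmu p : 2 * M p < 1 - mu' / mu.
  by apply: le_lt_trans epsmu; rewrite ler_wpM2l.
(* Up to order two the decay rate is sigma + k + |alpha|, so k cancels from the exponent of <x>. *)
have sC2 k (alpha : 'I_d -> nat) a x : (k + multi_order alpha <= 2)%N ->
    energies mu' a ->
    `|mixed_pderiv (energies mu' `*` setT) k alpha s (a, x)| <=
      C * a ^- k.+1 * jap x `^ (- sigma - (multi_order alpha)%:R).
  move=> ka2 Ia; have := sC k alpha a x (leq_trans ka2 _) Ia; move=> /(_ isT).
  rewrite /decay_rate ka2 natrD.
  by rewrite (_ : - (sigma + _) + _ = - sigma - (multi_order alpha)%:R)//; ring.
have sM k (alpha : 'I_d -> nat) p : (k + multi_order alpha <= 2)%N ->
    (energies mu' `*` [set x | x != 0]) p ->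
    `|Num.sqrt (2 * p.1) ^+ (2 * k) * enorm p.2 ^+ multi_order alpha *
      mixed_pderiv (energies mu' `*` setT) k alpha s p| <= M p.
  move=> ka2 [Ip _].
  exact (symbol_size_bound hmu' C0 s0 sC2 ka2 Ip).
split=> [t x Wtx|lambda_c lcP K Omega].
  have x0 : x != 0 := outgoing_neq0 hmu' hmu Wtx.
  have [a Ia ta] := critical_point_exists hmu' hmu Sk sk SE M0 M16 Mmu sM Wtx.
  exists a; split.
    by apply/(critical_pointE Sk t a x0).
  move=> b /(critical_pointE Sk t b x0)[Ib tb].
  exact: (critical_point_uniq hmu' hmu Sk sk SE M0 M16 Mmu sM Wtx Ia Ib ta tb).
have lamP p : outgoing mu p -> energies mu' (lambda_c p) /\
    pderiv (energies mu' `*` [set x | x != 0]) sdir (eikonal_solution chi V r)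
      (lambda_c p, p.2) = p.1.
  case: p => t x Wtx; have x0 : x != 0 := outgoing_neq0 hmu' hmu Wtx.
  by have /(critical_pointE Sk t _ x0) := lcP _ _ Wtx.
split.
- exact: (Ck_legendre hmu' hmu Sk sk SE M0 M16 Mmu sM lamP).
- move=> p Wp.
  exact: (hamilton_jacobi hmu' hmu Sk sk SE M0 M16 Mmu sM lamP Wp eik).
move=> k alpha ka2 t x Wtx.
have [Il _] := lamP _ Wtx; have l0 := energies_gt0 hmu' Il.
have [/= t0 _] := Wtx.
have jx0 := jap_gt0 x.
apply: le_trans (bound_mixed_pderiv hmu' hmu Sk sk SE M0 M16 Mmu sM lamP Wtx ka2) _.
(* Either the bound is zero, or |x| >= r >= 1, where <x> and |x| are comparable. *)
rewrite /= /M /symbol_size /=; case: ifP => [/andP[_ rx]|_]; last first.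
  rewrite mulr0 mul0r mulr_ge0 ?powR_ge0// mulr_ge0 ?powR_ge0//.
  by rewrite !mulr_ge0// ltW.
have := sqr_enorm_le_energy hmu' hmu Sk sk SE M0 M16 Mmu sM lamP Wtx.
rewrite /=; set la := lambda_c _ in l0 *; set m := multi_order alpha in ka2 *.
move=> N2.
have Nx0 : 0 < enorm x by rewrite (lt_le_trans _ rx)//; lra.
have jN : jap x ^+ m <= 4 * enorm x ^+ m.
  have m2 : (m <= 2)%N by rewrite (leq_trans _ ka2)// leq_addl.
  apply: (@le_trans _ _ ((2 * enorm x) ^+ m)).
    rewrite lerXn2r ?nnegrE ?mulr_ge0 ?(ltW jx0) ?(ltW Nx0)//.
    by rewrite jap_le_enorm// (le_trans r1).
  rewrite exprMn ler_wpM2r ?exprn_ge0 ?(ltW Nx0)//.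
  by case: (m) m2 => [|[|[|?]]] // _; rewrite ?expr0 ?expr1 ?expr2; lra.
rewrite powRB; last by apply/implyP => _; rewrite gt_eqF.
rewrite powRB; last by apply/implyP => _; rewrite gt_eqF.
rewrite !powR_mulrn ?(ltW t0) ?(ltW jx0)// powRr1 ?(ltW t0)// [t ^+ _.+1]exprS.
set J := jap x `^ _; have J0 : 0 <= J by exact: powR_ge0.
have tk0 : 0 < t ^+ k by rewrite exprn_gt0.
have Nm0 : 0 < enorm x ^+ m by rewrite exprn_gt0.
have jm0 : 0 < jap x ^+ m by rewrite exprn_gt0.
(* Both sides are brought to a common prefactor; what remains is |x|^2 / lambda <= 8 t^2 and |x|^-m
   <= 4 <x>^-m. *)
have -> : 40 * (4 * C / la * J) * (enorm x ^+ 2 / (enorm x ^+ m * (t * t ^+ k))) =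
    40 * (4 * C) * J / (t * t ^+ k) * ((enorm x ^+ 2 / la) * (enorm x ^+ m)^-1).
  by field; rewrite !gt_eqF.
have -> : 40 * (4 * (8 * (4 * C))) * (t / t ^+ k) * (J / jap x ^+ m) =
    40 * (4 * C) * J / (t * t ^+ k) * ((8 * t ^+ 2) * (4 / jap x ^+ m)).
  by field; rewrite !gt_eqF.
rewrite ler_wpM2l//; first
  by rewrite !mulr_ge0 ?invr_ge0 ?mulr_ge0 ?(ltW C0) ?(ltW t0) ?(ltW tk0).
apply: ler_pM.
- by rewrite divr_ge0 ?sqr_ge0// ltW.
- by rewrite invr_ge0 ltW.
- by rewrite ler_pdivrMr.
- by rewrite ler_pdivlMr// ler_pdivrMl// mulrC.
Qed.
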